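(* Let $G$ be a compact real algebraic group with neutral element $e$. Let $S \subset \mathbb{R}^n$ and $T \subset \mathbb{R}^N$ be $G$-semialgebraic sets and let $f : S \to T$ be an equivariant arc-analytic map. Suppose that for all $x \in S$, $G_x = \{e\}$. Then the induced map $f_{/G} : S/G \to T/G \subset \mathbb{R}^s$ between semialgebraic quotients is an arc-analytic map.
   Context: A real algebraic set of $\mathbb{R}^m$ is the zero set of a family of polynomials with real coefficients. A real algebraic group is a real algebraic set $G \subset \mathbb{R}^m$ with a group structure whose multiplication and inverse maps are restrictions of polynomial maps; it is compact if it is compact for the Euclidean topology. A $G$-real algebraic (resp. $G$-semialgebraic) set is a real algebraic (resp. semialgebraic) set in some $\mathbb{R}^n$ equipped with a group action of $G$ given by the restriction of a polynomial map. $G_x$ denotes the stabilizer of $x$. Geometric quotient: for a $G$-real algebraic set $X$, let $\mathcal{P}(X)$ be its $\mathbb{R}$-algebra of polynomial functions and $\mathcal{P}(X)^G$ the (finitely generated, since $G$ is compact) subalgebra of $G$-invariant ones. Choosing generators $f_1,\dots,f_r$ of $\mathcal{P}(X)^G$, the geometric quotient is $\pi_X : X \to X/\!\!/G\subset\mathbb{R}^r$, $x \mapsto (f_1(x),\dots,f_r(x))$, where $X/\!\!/G$ is the zero set of all polynomials $p$ with $p(f_1,\dots,f_r)=0$ on $X$. Semialgebraic quotient: if $S \subset \mathbb{R}^n$ is a $G$-semialgebraic set, its polynomial action extends uniquely to a polynomial action on its Zariski closure $Z$, making $Z$ a $G$-real algebraic set; put $S/G := \pi_Z(S)$ and $\varpi_S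 : S \to S/G$ the restriction of $\pi_Z$ (well-defined up to polynomial isomorphism). Two points of $S$ have the same image under $\varpi_S$ if and only if they are in the same $G$-orbit; hence an equivariant map $f : S \to T$ induces $f_{/G} : S/G \to T/G$, $\varpi_S(x) \mapsto \varpi_T(f(x))$. A map $f : A \to B$ between subsets of affine spaces is arc-analytic if for any real analytic arc $\gamma : ]-1;1[ \to A$ (analytic as a map into the ambient affine space), $f \circ \gamma$ is analytic. *)

(* Defs.v *)
From HB Require Import structures.
From mathcomp Require Import all_boot all_order all_algebra.
From mathcomp Require Import all_classical all_reals all_analysis.
(* The notations of mpoly clash with those of MathComp-Analysis: [mpoly n R]
   is the ring {mpoly R[n]} and [meval v p] is p.@[v]. *)
From mathcomp Require Import -(notations) mpoly.

Set Implicit Arguments.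
Unset Strict Implicit.
Unset Printing Implicit Defensive.

Import Order.TTheory GRing.Theory Num.Theory numFieldNormedType.Exports.

Local Open Scope classical_set_scope.
Local Open Scope ring_scope.

Section PolynomialMaps.
Variable R : realType.

Definition peval n (p : mpoly n R) (x : 'rV[R]_n) : R := meval (x ord0) p.

Definition polymap n k := 'I_k -> mpoly n R.

Definition pmeval n k (P : polymap n k) (x : 'rV[R]_n) : 'rV[R]_k :=
  \row_i peval (P i) x.

Lemma pevalX n (x : 'rV[R]_n) j : peval (mpolyX R (mnm1 j)) x = x ord0 j.
Proof. exact: mevalXU. Qed.

Lemma pevalB n (p q : mpoly n R) x : peval (p - q) x = peval p x - peval q x.
Proof. exact: mevalB. Qed.

Definition ppcomp n k (p : mpoly k R) (P : polymap n k) : mpoly n R :=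
  comp_mpoly [tuple P i | i < k] p.

Lemma peval_comp n k (p : mpoly k R) (P : polymap n k) x :
  peval (ppcomp p P) x = peval p (pmeval P x).
Proof.
rewrite /peval /ppcomp comp_mpoly_meval; apply: meval_eq => i.
by rewrite tnth_mktuple mxE.
Qed.

(* The polynomial map x |-> (a, x), for a fixed a. *)
Definition ppair m n (a : 'rV[R]_m) : polymap n (m + n) := fun i =>
  match fintype.split i with
  | inl j => mpolyC n (a ord0 j)
  | inr j => mpolyX R (mnm1 j)
  end.

Lemma pmeval_pair m n (a : 'rV[R]_m) (x : 'rV[R]_n) :
  pmeval (ppair a) x = row_mx a x.
Proof.
apply/rowP => i; rewrite !mxE /ppair; case: fintype.splitP => j _.
  by rewrite /peval mevalC.
by rewrite pevalX.
Qed.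

End PolynomialMaps.

Section RealAlgebraicSets.
Variable R : realType.

Definition zero_set n (I : set (mpoly n R)) : set 'rV[R]_n :=
  [set x | forall p, I p -> peval p x = 0].

Definition real_algebraic n (X : set 'rV[R]_n) : Prop :=
  exists I, X = zero_set I.

Definition vanishing n (X : set 'rV[R]_n) : set (mpoly n R) :=
  [set p | forall x, X x -> peval p x = 0].

Definition zariski_closure n (X : set 'rV[R]_n) : set 'rV[R]_n :=
  zero_set (vanishing X).

Lemma zariski_closure_algebraic n (X : set 'rV[R]_n) :
  real_algebraic (zariski_closure X).
Proof. by exists (vanishing X). Qed.

Lemma sub_zariski_closure n (X : set 'rV[R]_n) : X `<=` zariski_closure X.
Proof. by move=> x Xx p; apply. Qed.

Lemma zariski_closure_min n (X Y : set 'rV[R]_n) :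
  real_algebraic Y -> X `<=` Y -> zariski_closure X `<=` Y.
Proof. by move=> [I ->] XY z Zz p Ip; apply: Zz => x /XY; apply. Qed.

Lemma zariski_eq n (X : set 'rV[R]_n) (p q : mpoly n R) :
  (forall x, X x -> peval p x = peval q x) ->
  forall z, zariski_closure X z -> peval p z = peval q z.
Proof.
move=> pq z Zz; apply/eqP; rewrite -subr_eq0 -pevalB; apply/eqP.
by apply: Zz => x Xx; rewrite pevalB pq // subrr.
Qed.

(* The smallest class of subsets of R^n containing the sets {p > 0}, p
   polynomial, and closed under finite unions, finite intersections and
   complements. *)
Inductive semialgebraic n : set 'rV[R]_n -> Prop :=
| Semialgebraic_gt0 (p : mpoly n R) :
    semialgebraic [set x | 0 < peval p x]
| SemialgebraicU A B :
    semialgebraic A -> semialgebraic B -> semialgebraic (A `|` B)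
| SemialgebraicI A B :
    semialgebraic A -> semialgebraic B -> semialgebraic (A `&` B)
| SemialgebraicC A :
    semialgebraic A -> semialgebraic (~` A).

End RealAlgebraicSets.

Section RealAlgebraicGroups.
Variable R : realType.

(* The group operations are the restrictions to the carrier of the recorded
   polynomial maps, whose values elsewhere are irrelevant. *)
Record realAlgGroup m := RealAlgGroup {
  rag_set :> set 'rV[R]_m;
  rag_mulp : polymap R (m + m) m;
  rag_invp : polymap R m m;
  rag_e : 'rV[R]_m;
  rag_mul := fun g h => pmeval rag_mulp (row_mx g h);
  rag_inv := fun g => pmeval rag_invp g;
  rag_algebraic : real_algebraic rag_set;
  rag_e_in : rag_set rag_e;
  rag_mul_in : forall g h, rag_set g -> rag_set h -> rag_set (rag_mul g h);
  rag_inv_in : forall g, rag_set g -> rag_set (rag_inv g);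
  rag_mulA : forall g h k, rag_set g -> rag_set h -> rag_set k ->
    rag_mul g (rag_mul h k) = rag_mul (rag_mul g h) k;
  rag_mul1g : forall g, rag_set g -> rag_mul rag_e g = g;
  rag_mulg1 : forall g, rag_set g -> rag_mul g rag_e = g;
  rag_mulVg : forall g, rag_set g -> rag_mul (rag_inv g) g = rag_e;
  rag_mulgV : forall g, rag_set g -> rag_mul g (rag_inv g) = rag_e
}.

Variables (m : nat) (G : realAlgGroup m).

(* A subset of R^n with an action of G that is the restriction to G x X of the
   recorded polynomial map. *)
Record polyGset n := PolyGset {
  pg_set :> set 'rV[R]_n;
  pg_actp : polymap R (m + n) n;
  pg_act := fun g x => pmeval pg_actp (row_mx g x);
  pg_act_in : forall g x, rag_set G g -> pg_set x -> pg_set (pg_act g x);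
  pg_act1 : forall x, pg_set x -> pg_act (rag_e G) x = x;
  pg_actM : forall g h x, rag_set G g -> rag_set G h -> pg_set x ->
    pg_act (rag_mul G g h) x = pg_act g (pg_act h x)
}.

Definition G_real_algebraic n (X : polyGset n) : Prop := real_algebraic X.

Definition G_semialgebraic n (S : polyGset n) : Prop := semialgebraic S.

Definition stabilizer n (X : polyGset n) (x : 'rV[R]_n) : set 'rV[R]_m :=
  [set g | rag_set G g /\ pg_act X g x = x].

Definition equivariant n k (X : polyGset n) (Y : polyGset k)
    (f : 'rV[R]_n -> 'rV[R]_k) : Prop :=
  forall g x, rag_set G g -> pg_set X x -> f (pg_act X g x) = pg_act Y g (f x).

(* The extension of the action of G to the Zariski closure. *)
Section Closure.
Variables (n : nat) (S : polyGset n).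
Let Z := zariski_closure S.

(* The polynomial map x |-> g x, for a fixed g. *)
Let actp g : polymap R n n := fun i => ppcomp (pg_actp S i) (ppair g).

Let actpE g x : pmeval (actp g) x = pg_act S g x.
Proof. by apply/rowP => i; rewrite !mxE peval_comp pmeval_pair. Qed.

Lemma closure_act_in g x : rag_set G g -> Z x -> Z (pg_act S g x).
Proof.
move=> Gg Zx p pS; rewrite -actpE -peval_comp; apply: Zx => y Sy.
by rewrite peval_comp actpE; apply: pS; apply: pg_act_in.
Qed.

Lemma closure_act1 x : Z x -> pg_act S (rag_e G) x = x.
Proof.
move=> Zx; apply/rowP => i; rewrite -actpE mxE -[RHS]pevalX.
apply: (zariski_eq _ Zx) => y Sy.
by rewrite pevalX -{2}(pg_act1 Sy) -actpE mxE.
Qed.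

Lemma closure_actM g h x : rag_set G g -> rag_set G h -> Z x ->
  pg_act S (rag_mul G g h) x = pg_act S g (pg_act S h x).
Proof.
move=> Gg Gh Zx; apply/rowP => i; rewrite -!actpE !mxE -peval_comp.
apply: (zariski_eq _ Zx) => y Sy; rewrite peval_comp.
have /rowP/(_ i) := pg_actM Gg Gh Sy.
by rewrite -!actpE !mxE.
Qed.

Definition Gclosure : polyGset n :=
  @PolyGset n Z (pg_actp S) closure_act_in closure_act1 closure_actM.

Lemma Gclosure_algebraic : G_real_algebraic Gclosure.
Proof. exact: zariski_closure_algebraic. Qed.

End Closure.

(* p stands for its restriction to X, an element of P(X). *)
Definition invariant_on n (X : polyGset n) (p : mpoly n R) : Prop :=
  forall g x, rag_set G g -> pg_set X x -> peval p (pg_act X g x) = peval p x.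

(* The components of F generate the R-algebra P(X)^G.  The geometric quotient is
   then pmeval F : X -> X//G, where X//G is the Zariski closure of the image. *)
Definition geometric_quotient n (X : polyGset n) r (F : polymap R n r) : Prop :=
  (forall i, invariant_on X (F i)) /\
  (forall p, invariant_on X p ->
     exists q : mpoly r R, forall x, pg_set X x -> peval p x = peval q (pmeval F x)).

(* pmeval F : S -> R^r is the semialgebraic quotient map of S. *)
Definition semialgebraic_quotient n (S : polyGset n) r (F : polymap R n r) : Prop :=
  geometric_quotient (Gclosure S) F.

(* S/G, as a subset of R^r *)
Definition quotient_set n (S : polyGset n) r (F : polymap R n r) : set 'rV[R]_r :=
  pmeval F @` S.

(* The map F(x) |-> E(f(x)), x in S, from S/G to T/G.  For G compact and f equivariant,
   the set of values E(f(x)), x in S with F(x) = y, is a singleton for every y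
   in S/G, because the fibres of the quotient map of S are orbits. *)
Definition quotient_map n k (S : polyGset n) r (F : polymap R n r)
    s (E : polymap R k s) (f : 'rV[R]_n -> 'rV[R]_k) (y : 'rV[R]_r) : 'rV[R]_s :=
  xget 0 [set pmeval E (f x) | x in [set x | pg_set S x /\ pmeval F x = y]].

End RealAlgebraicGroups.

Section ArcAnalytic.
Variable R : realType.

Definition analytic_at (u : R -> R) (t0 : R) : Prop :=
  exists c : R^nat,
    \forall t \near t0, pseries c (t - t0) @ \oo --> u t.

(* Only the values of gamma on ]-1, 1[ matter. *)
Definition analytic_arc n (gamma : R -> 'rV[R]_n) : Prop :=
  forall t0, -1 < t0 < 1 -> forall i, analytic_at (fun t => gamma t ord0 i) t0.

(* f is a map from A to B; its values outside A are irrelevant. *)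
Definition arc_analytic n k (A : set 'rV[R]_n) (B : set 'rV[R]_k)
    (f : 'rV[R]_n -> 'rV[R]_k) : Prop :=
  set_fun A B f /\
  forall gamma : R -> 'rV[R]_n,
    analytic_arc gamma -> (forall t, -1 < t < 1 -> A (gamma t)) ->
    analytic_arc (f \o gamma).

End ArcAnalytic.

(* Main.v *)
Require Import Defs.
From mathcomp Require Import all_boot all_order all_algebra.
From mathcomp Require Import all_classical all_reals all_analysis.
From mathcomp Require Import -(notations) mpoly.
From mathcomp Require Import ring lra.
Import Order.TTheory GRing.Theory Num.Theory numFieldNormedType.Exports.
Local Open Scope classical_set_scope.
Local Open Scope ring_scope.

Set Implicit Arguments.
Unset Strict Implicit.
Unset Printing Implicit Defensive.

(* It suffices to lift an analytic arc of S/G locally to an analytic arc of S: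
   compose the lift with f and with the quotient map of T.

   Let d(x, y) be the Haar mean over g of |g x - g y|^2, a G-invariant
   polynomial, and lift a point y of S/G near the image of x0 to a point z of
   its fibre that minimizes d(z, x0) over the orbit. The components of the lift
   are analytic by the analytic inverse function theorem, once every
   v <> 0 in R^n has a polynomial q with dq(x0) v <> 0 whose value at z depends
   polynomially on y. If an invariant q satisfies dq(x0) v <> 0, it is one.
   If v is killed by the differentials of all invariants, put
   E(x) = d(x, x0) + d(x, z): as z is nearest to x0 and stabilizers are trivial,
   g |-> E(g x0) is minimal at g = e only, so the differentials at x0 of the
   invariants mean_g (rho - E(g x))^k, suitably normalized, converge to
   -dE(x0); thus dE(x0) v = 0. This is a polynomial equation in z, whose
   differential in z at x0 is, on v, a multiple of the mean of |d_v (g x)|^2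
   over g, which is nonzero; its left-hand side is the required q. *)

(** * Polynomial functions *)

(** X may be singular at x0, so no tangent space of a manifold is at hand: v ranges over all of R^n,
    and the polynomials vanishing on X, being invariant, detect the directions that leave X. The
    recorded action polynomials define an action on X only, whereas differentials need formulas
    valid on all of R^n; hence means are kept as expressions in the ambient coordinates. The
    minimizer z is picked pointwise, without continuity. Continuity comes from the chart: near x0, n
    polynomials with independent differentials bound the distance of two minimizers by the
    differences of their values, and these values are polynomials in y. Analyticity is claimed along
    an arc only, so power series in one variable suffice, represented by sequences of polynomials
    with a common norm bound. Likewise the Haar mean is needed on polynomial functions only, where
    it is the one constant that finite averages of translates approach uniformly. Means of high
    powers of a function with a peak serve twice: to separate orbits by invariants, and to localize
    at e. *)

Section PolynomialFunctions.
Variable R : realType.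

Lemma mpoly_ring_ind n (P : mpoly n R -> Prop) :
  (forall c, P (mpolyC n c)) -> (forall i, P (mpolyX R (mnm1 i))) ->
  (forall p q, P p -> P q -> P (p + q)) ->
  (forall p q, P p -> P q -> P (p * q)) -> forall p, P p.
Proof.
move=> PC PX PD PM; elim/mpolyind => [|c k p _ _ Pp].
  by rewrite -(mpolyC0 n); exact: PC.
apply: (PD _ _ _ Pp); rewrite -mul_mpolyC; apply: (PM _ _ (PC _)).
rewrite mpolyXE_id; elim/big_ind: _ => //; first exact: (PC 1).
move=> i _; elim: (k i) => [|j IH]; first by rewrite expr0; exact: (PC 1).
by rewrite exprS; exact: PM.
Qed.

Lemma pevalC n c (x : 'rV[R]_n) : peval (mpolyC n c) x = c.
Proof. exact: mevalC. Qed.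

Lemma pevalD n (p q : mpoly n R) x : peval (p + q) x = peval p x + peval q x.
Proof. exact: mevalD. Qed.

Lemma pevalM n (p q : mpoly n R) x : peval (p * q) x = peval p x * peval q x.
Proof. exact: mevalM. Qed.

(** Hides the polynomial, so that means, averages and compositions can be recognized as polynomial
    without computing coefficients. *)
Definition polyfun n (f : 'rV[R]_n -> R) := exists p, forall x, f x = peval p x.

Lemma polyfun_peval n (p : mpoly n R) : polyfun (peval p).
Proof. by exists p. Qed.

Lemma eq_polyfun n (f g : 'rV[R]_n -> R) : f =1 g -> polyfun f -> polyfun g.
Proof. by move=> /funext ->. Qed.

Lemma polyfun_ind n (P : ('rV[R]_n -> R) -> Prop) :
  (forall c, P (fun=> c)) -> (forall i, P (fun x => x ord0 i)) ->
  (forall f g, P f -> P g -> P (fun x => f x + g x)) ->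
  (forall f g, P f -> P g -> P (fun x => f x * g x)) ->
  forall f, polyfun f -> P f.
Proof.
move=> PC PX PD PM f [p /funext ->] {f}; elim/mpoly_ring_ind: p => [c|i|p q Pp Pq|p q Pp Pq].
- by rewrite (_ : peval _ = fun=> c)//; apply/funext => x; rewrite pevalC.
- by rewrite (_ : peval _ = fun x => x ord0 i)//; apply/funext => x; rewrite pevalX.
- by rewrite (_ : peval _ = fun x => peval p x + peval q x); [exact: PD|
    apply/funext => x; rewrite pevalD].
- by rewrite (_ : peval _ = fun x => peval p x * peval q x); [exact: PM|
    apply/funext => x; rewrite pevalM].
Qed.

Lemma polyfun_cst n c : polyfun (fun _ : 'rV[R]_n => c).
Proof. by exists (mpolyC n c) => x; rewrite pevalC. Qed.

Lemma polyfun_coord n i : polyfun (fun x : 'rV[R]_n => x ord0 i).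
Proof. by exists (mpolyX R (mnm1 i)) => x; rewrite pevalX. Qed.

Lemma polyfunD n (f g : 'rV[R]_n -> R) :
  polyfun f -> polyfun g -> polyfun (fun x => f x + g x).
Proof. by move=> [p fp] [q gq]; exists (p + q) => x; rewrite pevalD fp gq. Qed.

Lemma polyfunM n (f g : 'rV[R]_n -> R) :
  polyfun f -> polyfun g -> polyfun (fun x => f x * g x).
Proof. by move=> [p fp] [q gq]; exists (p * q) => x; rewrite pevalM fp gq. Qed.

Lemma polyfunB n (f g : 'rV[R]_n -> R) :
  polyfun f -> polyfun g -> polyfun (fun x => f x - g x).
Proof. by move=> [p fp] [q gq]; exists (p - q) => x; rewrite pevalB fp gq. Qed.

Lemma polyfunX n (f : 'rV[R]_n -> R) k : polyfun f -> polyfun (fun x => f x ^+ k).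
Proof.
move=> pf; elim: k => [|k IH]; first exact: (polyfun_cst n 1).
by apply: eq_polyfun (polyfunM pf IH) => x; rewrite exprS.
Qed.

Lemma polyfun_sum n (I : Type) (s : seq I) (P : pred I) (f : I -> 'rV[R]_n -> R) :
  (forall i, polyfun (f i)) -> polyfun (fun x => \sum_(i <- s | P i) f i x).
Proof.
move=> pf; elim: s => [|i s IH].
  by apply: eq_polyfun (polyfun_cst n 0) => x; rewrite big_nil.
have [Pi|Pi] := boolP (P i).
  by apply: eq_polyfun (polyfunD (pf i) IH) => x; rewrite big_cons Pi.
by apply: eq_polyfun IH => x; rewrite big_cons (negbTE Pi).
Qed.

Definition polyfunv n k (f : 'rV[R]_n -> 'rV[R]_k) :=
  forall i, polyfun (fun x => f x ord0 i).

Lemma polyfun_comp n k (f : 'rV[R]_k -> R) (g : 'rV[R]_n -> 'rV[R]_k) :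
  polyfun f -> polyfunv g -> polyfun (f \o g).
Proof.
move=> pf pg; elim/polyfun_ind: pf => [c|i|f1 f2 p1 p2|f1 f2 p1 p2].
- exact: polyfun_cst.
- exact: pg.
- exact: polyfunD.
- exact: polyfunM.
Qed.

Lemma polyfunv_comp n k l (f : 'rV[R]_k -> 'rV[R]_l) (g : 'rV[R]_n -> 'rV[R]_k) :
  polyfunv f -> polyfunv g -> polyfunv (f \o g).
Proof. by move=> pf pg i; exact: (polyfun_comp (pf i)). Qed.

Lemma polyfunv_id n : polyfunv (@id 'rV[R]_n).
Proof. exact: polyfun_coord. Qed.

Lemma polyfunv_cst n k (a : 'rV[R]_k) : polyfunv (fun _ : 'rV[R]_n => a).
Proof. by move=> i; exact: polyfun_cst. Qed.

Lemma polyfunv_pmeval n k (P : polymap R n k) : polyfunv (pmeval P).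
Proof. by move=> i; exists (P i) => x; rewrite mxE. Qed.

Lemma polyfunv_row n k l (f : 'rV[R]_n -> 'rV[R]_k) (g : 'rV[R]_n -> 'rV[R]_l) :
  polyfunv f -> polyfunv g -> polyfunv (fun x => row_mx (f x) (g x)).
Proof.
move=> pf pg i; have [j ->|j ->] := fintype.split_ordP i.
  by apply: eq_polyfun (pf j) => x; rewrite row_mxEl.
by apply: eq_polyfun (pg j) => x; rewrite row_mxEr.
Qed.

Lemma polyfunv_l n k : polyfunv (@lsubmx R 1 n k).
Proof.
by move=> i; apply: eq_polyfun (polyfun_coord (lshift k i)) => x; rewrite mxE.
Qed.

Lemma polyfunv_r n k : polyfunv (@rsubmx R 1 n k).
Proof.
by move=> i; apply: eq_polyfun (polyfun_coord (rshift n i)) => x; rewrite mxE.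
Qed.

Lemma polyfunvD n k (f g : 'rV[R]_n -> 'rV[R]_k) :
  polyfunv f -> polyfunv g -> polyfunv (fun x => f x + g x).
Proof.
by move=> pf pg i; apply: eq_polyfun (polyfunD (pf i) (pg i)) => x; rewrite mxE.
Qed.

Lemma polyfunvB n k (f g : 'rV[R]_n -> 'rV[R]_k) :
  polyfunv f -> polyfunv g -> polyfunv (fun x => f x - g x).
Proof.
by move=> pf pg i; apply: eq_polyfun (polyfunB (pf i) (pg i)) => x; rewrite !mxE.
Qed.

Lemma norm_coord n (x : 'rV[R]_n) i : `|x ord0 i| <= `|x|.
Proof.
rewrite -[leRHS]/(mx_norm x) mx_normrE.
by apply/bigmax_geP; right => /=; exists (ord0, i).
Qed.

Lemma norm_row_le n (x : 'rV[R]_n) c : 0 <= c ->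
  (forall i, `|x ord0 i| <= c) -> `|x| <= c.
Proof.
move=> c0 h; rewrite -[`|x|]/(mx_norm x) mx_normrE; apply/bigmax_leP; split=> // -[i j] _.
by rewrite /= [i]ord1.
Qed.

Lemma norm_row_lt n (x : 'rV[R]_n) c : 0 < c ->
  (forall i, `|x ord0 i| < c) -> `|x| < c.
Proof.
move=> c0 h; rewrite -[`|x|]/(mx_norm x) mx_normrE; apply/bigmax_ltP; split=> // -[i j] _.
by rewrite /= [i]ord1.
Qed.

Lemma norm_row_mx n k (x : 'rV[R]_n) (y : 'rV[R]_k) c : `|x| <= c -> `|y| <= c ->
  `|row_mx x y| <= c.
Proof.
move=> xc yc; apply: norm_row_le => [|i]; first exact: le_trans xc.
have [j ->|j ->] := fintype.split_ordP i; rewrite ?row_mxEl ?row_mxEr.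
  exact: le_trans (norm_coord _ _) _.
exact: le_trans (norm_coord _ _) _.
Qed.

Lemma polyfun_bounded n (f : 'rV[R]_n -> R) B : polyfun f ->
  exists2 C : R, 0 <= C & forall x : 'rV[R]_n, `|x| <= B -> `|f x| <= C.
Proof.
elim/polyfun_ind => [c|i|f1 f2 [C1 C10 h1] [C2 C20 h2]|f1 f2 [C1 C10 h1] [C2 C20 h2]].
- by exists `|c|.
- exists `|B| => // x xB; rewrite (le_trans (norm_coord _ _))// (le_trans xB)//.
  exact: ler_norm.
- exists (C1 + C2) => [|x xB]; first exact: addr_ge0.
  by rewrite (le_trans (ler_normD _ _))// lerD ?h1 ?h2.
- exists (C1 * C2) => [|x xB]; first exact: mulr_ge0.
  by rewrite normrM ler_pM ?h1 ?h2.
Qed.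

Lemma polyfun_lipschitz n (f : 'rV[R]_n -> R) B : polyfun f ->
  exists2 L : R, 0 < L & forall x y : 'rV[R]_n, `|x| <= B -> `|y| <= B ->
    `|f x - f y| <= L * `|x - y|.
Proof.
(* The product case bounds the factors themselves, so the induction has to carry [polyfun f] along.
   A positive L, convenient as a divisor, is restored at the end. *)
suff h : polyfun f -> polyfun f /\ exists2 L : R, 0 <= L &
    forall x y : 'rV[R]_n, `|x| <= B -> `|y| <= B -> `|f x - f y| <= L * `|x - y|.
  move=> /h[_ [L L0 hL]]; exists (L + 1) => [|x y xB yB]; first by rewrite ltr_wpDl.
  by rewrite (le_trans (hL _ _ xB yB))// ler_wpM2r// lerDl.
elim/polyfun_ind => [c|i|f1 f2 [p1 [L1 L10 h1]] [p2 [L2 L20 h2]]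
    |f1 f2 [p1 [L1 L10 h1]] [p2 [L2 L20 h2]]].
- by split; [exact: polyfun_cst|exists 0 => // x y _ _; rewrite subrr normr0 mul0r].
- split; first exact: polyfun_coord.
  by exists 1 => // x y _ _; rewrite mul1r (le_trans _ (norm_coord _ i))// !mxE.
- split; first exact: polyfunD.
  exists (L1 + L2) => [|x y xB yB]; first exact: addr_ge0.
  rewrite opprD addrACA (le_trans (ler_normD _ _))// mulrDl.
  by rewrite lerD ?h1 ?h2.
- split; first exact: polyfunM.
  have [C1 C10 b1] := polyfun_bounded B p1; have [C2 C20 b2] := polyfun_bounded B p2.
  exists (L1 * C2 + C1 * L2) => [|x y xB yB]; first by rewrite addr_ge0// mulr_ge0.
  rewrite (_ : _ - _ = (f1 x - f1 y) * f2 x + f1 y * (f2 x - f2 y)); last by ring.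
  rewrite (le_trans (ler_normD _ _))// !normrM mulrDl lerD//.
    by rewrite mulrAC ler_pM ?h1 ?b2.
  by rewrite -mulrA ler_pM ?h2 ?b1.
Qed.

Lemma polyfunv_bounded n k (f : 'rV[R]_n -> 'rV[R]_k) B : polyfunv f ->
  exists2 C : R, 0 <= C & forall x : 'rV[R]_n, `|x| <= B -> `|f x| <= C.
Proof.
move=> pf; have /choice[C hC] : forall i, exists C, 0 <= C /\
    forall x, `|x| <= B -> `|f x ord0 i| <= C.
  by move=> i; have [C ? ?] := polyfun_bounded B (pf i); exists C.
exists (\sum_i C i) => [|x xB]; first by apply: sumr_ge0 => i _; case: (hC i).
apply: norm_row_le => [|i]; first by apply: sumr_ge0 => i _; case: (hC i).
rewrite (le_trans ((hC i).2 x xB))// (bigD1 i)//= lerDl sumr_ge0// => j _.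
by case: (hC j).
Qed.

Lemma polyfunv_lipschitz n k (f : 'rV[R]_n -> 'rV[R]_k) B : polyfunv f ->
  exists2 L : R, 0 < L & forall x y : 'rV[R]_n, `|x| <= B -> `|y| <= B ->
    `|f x - f y| <= L * `|x - y|.
Proof.
move=> pf; have /choice[C hC] : forall i, exists L, 0 < L /\ forall x y, `|x| <= B -> `|y| <= B ->
    `|f x ord0 i - f y ord0 i| <= L * `|x - y|.
  by move=> i; have [C ? ?] := polyfun_lipschitz B (pf i); exists C.
have C0 : 0 <= \sum_i C i by apply: sumr_ge0 => i _; case: (hC i) => /ltW.
exists (1 + \sum_i C i) => [|x y xB yB]; first by rewrite ltr_pwDl.
apply: norm_row_le => [|i]; first by rewrite mulr_ge0// addr_ge0.
rewrite !mxE (le_trans ((hC i).2 x y xB yB))// ler_wpM2r//.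
rewrite (bigD1 i)//= addrCA lerDl addr_ge0// sumr_ge0// => j _.
by case: (hC j) => /ltW.
Qed.

Lemma polyfun_continuous n (f : 'rV[R]_n -> R) : polyfun f -> continuous f.
Proof.
elim/polyfun_ind => [c|i|f1 f2 h1 h2|f1 f2 h1 h2] x.
- exact: (@cst_continuous _ _ c).
- exact: coord_continuous.
- exact: (continuousD (h1 x) (h2 x)).
- exact: (continuousM (h1 x) (h2 x)).
Qed.

Lemma compact_polyfun_min n (A : set 'rV[R]_n) (f : 'rV[R]_n -> R) :
  compact A -> A !=set0 -> polyfun f -> exists2 a, A a & forall b, A b -> f a <= f b.
Proof.
move=> Ac A0 pf; have [a aA h] := EVT_min_rV A0 Ac
  (continuous_subspaceT (polyfun_continuous pf)).
by exists a => [|b Ab]; [exact/set_mem|apply: h; exact/mem_set].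
Qed.

Lemma compact_net n (A : set 'rV[R]_n) d : compact A -> 0 < d ->
  exists s : seq 'rV[R]_n, (forall a : 'rV[R]_n, a \in s -> A a) /\
    forall x, A x -> exists2 a : 'rV[R]_n, a \in s & `|a - x| < d.
Proof.
move=> Ac d0; have : cover_compact A by rewrite -compact_cover.
move=> /(_ _ A (fun a => [set x | `|a - x| < d])) [] //.
- move=> a Aa; rewrite (_ : [set _ | _] = ball a d); first exact: ball_open.
  by rewrite -ball_normE.
- by move=> x Ax; exists x => //=; rewrite subrr normr0.
move=> D DA cA; exists (finmap.enum_fset D); split=> [a aD|x /cA [a aD ad]].
  exact/set_mem/DA.
by exists a.
Qed.

Definition dpeval n (p : mpoly n R) (x u : 'rV[R]_n) : R :=
  \sum_i u ord0 i * peval (mderiv i p) x.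

Lemma dpevalC n c (x u : 'rV[R]_n) : dpeval (mpolyC n c) x u = 0.
Proof.
rewrite /dpeval big1// => i _.
by rewrite mderivC -(mpolyC0 n) pevalC mulr0.
Qed.

Lemma dpevalX n j (x u : 'rV[R]_n) : dpeval (mpolyX R (mnm1 j)) x u = u ord0 j.
Proof.
rewrite /dpeval (bigD1 j)//= big1 => [|i ij]; rewrite mderivX mnm1E.
  rewrite eqxx scale1r addr0 (_ : mnm_sub _ _ = mnm0) ?mpolyX0; last first.
    by apply/mnmP => k; rewrite mnmBE subnn mnm0E.
  by rewrite (pevalC 1) mulr1.
by rewrite eq_sym (negbTE ij) scale0r -(mpolyC0 n) pevalC mulr0.
Qed.

Lemma dpevalD n (p q : mpoly n R) x u :
  dpeval (p + q) x u = dpeval p x u + dpeval q x u.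
Proof.
rewrite /dpeval -big_split; apply: eq_bigr => i _.
by rewrite mderivD pevalD mulrDr.
Qed.

Lemma dpevalM n (p q : mpoly n R) x u :
  dpeval (p * q) x u = dpeval p x u * peval q x + peval p x * dpeval q x u.
Proof.
rewrite /dpeval mulr_suml mulr_sumr -big_split; apply: eq_bigr => i _ /=.
by rewrite mderivM pevalD !pevalM; ring.
Qed.

Lemma polyfun_dpeval n (p : mpoly n R) u : polyfun (fun x => dpeval p x u).
Proof.
apply: polyfun_sum => i; apply: polyfunM; first exact: polyfun_cst.
exact: polyfun_peval.
Qed.

Lemma dpeval_le n (p : mpoly n R) B :
  exists2 C : R, 0 <= C & forall x u : 'rV[R]_n, `|x| <= B -> `|dpeval p x u| <= C * `|u|.
Proof.
have /choice[C hC] : forall i : 'I_n, exists C, 0 <= C /\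
    forall x, `|x| <= B -> `|peval (mderiv i p) x| <= C.
  by move=> i; have [C] := polyfun_bounded B (polyfun_peval (mderiv i p)); exists C.
exists (\sum_i C i) => [|x u xB]; first by apply: sumr_ge0 => i _; case: (hC i).
rewrite (le_trans (ler_norm_sum _ _ _))// mulr_suml ler_sum// => i _.
by rewrite normrM mulrC ler_pM ?norm_coord//; exact: (hC i).2.
Qed.

(** One constant serves all x in the ball; differentiation under the mean over G relies on this
    uniformity. *)
Lemma taylor2 n (p : mpoly n R) B : exists2 C : R, 0 <= C & forall x u : 'rV[R]_n,
  `|x| <= B -> `|u| <= B -> `|peval p (x + u) - peval p x - dpeval p x u| <= C * `|u| ^+ 2.
Proof.
elim/mpoly_ring_ind: p => [c|i|p q [C C0 hC] [D D0 hD]|p q [C C0 hC] [D D0 hD]].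
- by exists 0 => // x u _ _; rewrite !pevalC dpevalC !subrr normr0 mul0r.
- exists 0 => // x u _ _; rewrite !pevalX dpevalX !mxE.
  by rewrite (addrC (x ord0 i)) addrK subrr normr0 mul0r.
- exists (C + D) => [|x u xB uB]; first exact: addr_ge0.
  rewrite !pevalD dpevalD mulrDl; apply: le_trans (lerD (hC x u xB uB) (hD x u xB uB)).
  by rewrite (le_trans _ (ler_normD _ _))// le_eqVlt; apply/orP; left;
    apply/eqP; congr `| _ |; ring.
- have [P P0 hP] := polyfun_bounded (B + B) (polyfun_peval p).
  have [Q Q0 hQ] := polyfun_bounded (B + B) (polyfun_peval q).
  have [P' P'0 hP'] := dpeval_le p B; have [Q' Q'0 hQ'] := dpeval_le q B.
  have [L /ltW L0 hL] := polyfun_lipschitz (B + B) (polyfun_peval q).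
  exists (C * Q + P * D + P' * L) => [|x u xB uB]; first by rewrite !addr_ge0 ?mulr_ge0.
  have B0 : 0 <= B := le_trans (normr_ge0 _) xB.
  have xB' : `|x| <= B + B by rewrite ler_wpDl.
  have xuB : `|x + u| <= B + B by rewrite (le_trans (ler_normD _ _))// lerD.
  have -> : peval (p * q) (x + u) - peval (p * q) x - dpeval (p * q) x u =
    (peval p (x + u) - peval p x - dpeval p x u) * peval q (x + u) +
    peval p x * (peval q (x + u) - peval q x - dpeval q x u) +
    dpeval p x u * (peval q (x + u) - peval q x).
    by rewrite !pevalM dpevalM; ring.
  have u2 : 0 <= `|u| ^+ 2 by exact: sqr_ge0.
  rewrite (le_trans (ler_normD _ _))// (le_trans (lerD (ler_normD _ _) (lexx _)))//.
  rewrite !normrM !mulrDl; apply: lerD; first apply: lerD.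
  + by rewrite mulrAC ler_pM// ?hC// hQ.
  + by rewrite -mulrA ler_pM// ?hP// hD.
  + rewrite expr2 mulrACA ler_pM// ?hP'//.
    by rewrite (le_trans (hL _ _ xuB xB'))// addrC addKr.
Qed.

End PolynomialFunctions.

(** * The Haar mean of polynomial functions *)

Lemma sum_seq_le (R : realType) (T : eqType) (s : seq T) (F : T -> R) c :
  (forall a, a \in s -> F a <= c) -> \sum_(a <- s) F a <= (size s)%:R * c.
Proof.
elim: s => [|a s IH] h; first by rewrite big_nil mul0r.
rewrite big_cons /= -natr1 mulrDl mul1r addrC lerD ?h ?mem_head//.
by apply: IH => b bs; rewrite h// inE bs orbT.
Qed.

Section InvariantMean.
Variables (R : realType) (m : nat) (G : realAlgGroup R m).
Hypothesis Gcompact : compact (G : set 'rV[R]_m).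

Local Notation mul := (rag_mul G).
Local Notation inv := (rag_inv G).
Local Notation e := (rag_e G).
Local Notation inG x := (rag_set G x).

Lemma rag_invK x : inG x -> inv (inv x) = x.
Proof.
move=> Gx; have Gx' := rag_inv_in Gx; have Gx'' := rag_inv_in Gx'.
by rewrite -[RHS](rag_mul1g Gx) -(rag_mulVg Gx') -rag_mulA// rag_mulVg// rag_mulg1.
Qed.

Lemma rag_invM x y : inG x -> inG y -> inv (mul x y) = mul (inv y) (inv x).
Proof.
move=> Gx Gy; have Gx' := rag_inv_in Gx; have Gy' := rag_inv_in Gy.
have Gxy := rag_mul_in Gx Gy; have Gyx := rag_mul_in Gy' Gx'.
rewrite -[LHS](rag_mulg1 (rag_inv_in Gxy)).
rewrite (_ : e = mul (mul x y) (mul (inv y) (inv x))).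
  by rewrite rag_mulA ?rag_mulVg ?rag_mul1g//; exact: rag_inv_in.
by rewrite -rag_mulA// (rag_mulA Gy)// rag_mulgV// rag_mul1g// rag_mulgV.
Qed.

Lemma rag_bounded : exists2 B : R, 0 < B & forall x, inG x -> `|x| <= B.
Proof.
have [M [Mr h]] := compact_bounded Gcompact.
exists (`|M| + 1) => [|x Gx]; first by rewrite ltr_wpDl.
by apply: (h (`|M| + 1)) => //; rewrite ltr_pwDr// ler_norm.
Qed.

Lemma polyfunv_mul n (f g : 'rV[R]_n -> 'rV[R]_m) :
  polyfunv f -> polyfunv g -> polyfunv (fun x => mul (f x) (g x)).
Proof.
move=> pf pg; exact: (polyfunv_comp (@polyfunv_pmeval _ _ _ _) (polyfunv_row pf pg)).
Qed.

Lemma polyfunv_inv n (f : 'rV[R]_n -> 'rV[R]_m) :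
  polyfunv f -> polyfunv (fun x => inv (f x)).
Proof. by move=> pf; exact: (polyfunv_comp (@polyfunv_pmeval _ _ _ _) pf). Qed.

(** A sequence and not a set: products are counted with multiplicity, so that averaging over
    [mulseq B A] is exactly an iterated average. *)
Definition ingrp (A : seq 'rV[R]_m) := (0 < size A)%N /\ forall a, a \in A -> inG a.

Definition avg (A : seq 'rV[R]_m) (f : 'rV[R]_m -> R) (x : 'rV[R]_m) : R :=
  (\sum_(a <- A) f (mul x a)) / (size A)%:R.

Definition mulseq (B A : seq 'rV[R]_m) := [seq mul b a | b <- B, a <- A].

Lemma ingrp_mulseq B A : ingrp B -> ingrp A -> ingrp (mulseq B A).
Proof.
move=> [B0 GB] [A0 GA]; split; first by rewrite size_allpairs muln_gt0 B0.
by move=> _ /allpairsP[[b a] [/= bB aA ->]]; apply: rag_mul_in; [exact: GB|exact: GA].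
Qed.

Lemma avg_mulseq B A f x : ingrp B -> ingrp A -> inG x ->
  avg (mulseq B A) f x = avg B (avg A f) x.
Proof.
move=> [B0 GB] [A0 GA] Gx; rewrite /avg /mulseq size_allpairs big_allpairs_dep.
rewrite natrM invfM mulrA mulrAC; congr (_ / _); rewrite mulr_suml.
apply: eq_big_seq => b bB; congr (_ / _).
by apply: eq_big_seq => a aA; rewrite rag_mulA//; [exact: GB|exact: GA].
Qed.

Lemma avg_le A f x c : ingrp A -> inG x -> (forall y, inG y -> f y <= c) ->
  avg A f x <= c.
Proof.
move=> [A0 GA] Gx h; rewrite /avg ler_pdivrMr ?ltr0n// mulrC.
by apply: sum_seq_le => a aA; apply: h; apply: rag_mul_in => //; exact: GA.
Qed.

Lemma avgB A f g x : avg A (fun y => f y - g y) x = avg A f x - avg A g x.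
Proof. by rewrite /avg sumrB mulrBl. Qed.

Lemma avgZ A k f x : avg A (fun y => k * f y) x = k * avg A f x.
Proof. by rewrite /avg -mulr_sumr mulrA. Qed.

Lemma avgD A f g x : avg A (fun y => f y + g y) x = avg A f x + avg A g x.
Proof. by rewrite /avg big_split mulrDl. Qed.

Lemma avg_cst A c x : ingrp A -> avg A (fun=> c) x = c.
Proof.
move=> [A0 _]; rewrite /avg big_const_seq count_predT iter_addr_0 -[c *+ _]mulr_natr mulfK//.
by rewrite pnatr_eq0 -lt0n.
Qed.

Lemma avg_norm_le A f x c d : ingrp A -> inG x ->
  (forall y, inG y -> `|f y - c| <= d) -> `|avg A f x - c| <= d.
Proof.
move=> GA Gx h; rewrite -(avg_cst c x GA) -avgB ler_norml; apply/andP; split.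
  rewrite lerNl -mulN1r -avgZ; apply: avg_le => // y Gy.
  by rewrite mulN1r lerNl; have := h y Gy; rewrite ler_norml => /andP[].
by apply: avg_le => // y Gy; have := h y Gy; rewrite ler_norml => /andP[].
Qed.

Lemma polyfun_avg A f : polyfun f -> polyfun (avg A f).
Proof.
move=> pf; apply: polyfunM; last exact: polyfun_cst.
apply: polyfun_sum => a; apply: (polyfun_comp pf).
by apply: polyfunv_mul; [exact: polyfunv_id|exact: polyfunv_cst].
Qed.

(** Take for b a point of the net close to x^-1 z: then x b is close to z. The function f(x g a) is
    polynomial in (x, g, a) jointly, hence Lipschitz on the bounded group with a constant that does
    not depend on x or a. *)
Lemma equicontinuous_net f (d : R) : polyfun f -> 0 < d ->
  exists2 L, ingrp L & forall x z, inG x -> inG z ->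
    exists2 b, b \in L & forall a, inG a -> `|f (mul (mul x b) a) - f (mul z a)| <= d.
Proof.
move=> pf d0; have [B B0 hB] := rag_bounded.
pose F (w : 'rV[R]_(m + (m + m))) :=
  f (mul (lsubmx w) (mul (lsubmx (rsubmx w)) (rsubmx (rsubmx w)))).
have pF : polyfun F.
  apply: (polyfun_comp pf); apply: polyfunv_mul; first exact: polyfunv_l.
  apply: polyfunv_mul.
    exact: (polyfunv_comp (@polyfunv_l _ _ _) (@polyfunv_r _ _ _)).
  exact: (polyfunv_comp (@polyfunv_r _ _ _) (@polyfunv_r _ _ _)).
have [K K0 hK] := polyfun_lipschitz B pF.
have [L [GL hL]] := compact_net Gcompact (divr_gt0 d0 K0).
exists L.
  by split=> //; have [a aL _] := hL _ (rag_e_in G); case: L aL {GL hL}.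
move=> x z Gx Gz; have Gx' := rag_inv_in Gx; have Gy := rag_mul_in Gx' Gz.
have [b bL bd] := hL _ Gy; exists b => // a Ga; have Gb := GL _ bL.
have -> : mul (mul x b) a = mul x (mul b a) by rewrite rag_mulA.
have -> : mul z a = mul x (mul (mul (inv x) z) a).
  by rewrite !rag_mulA// rag_mulgV// rag_mul1g.
pose w (g : 'rV[R]_m) := row_mx x (row_mx g a).
have FE g : F (w g) = f (mul x (mul g a)) by rewrite /F /w !(row_mxKl, row_mxKr).
rewrite -!FE; have nw g : inG g -> `|w g| <= B.
  by move=> Gg; rewrite !norm_row_mx ?hB.
apply: le_trans (hK _ _ (nw _ Gb) (nw _ Gy)) _.
rewrite mulrC -ler_pdivlMr//; apply: le_trans (ltW bd).
rewrite /w !opp_row_mx !add_row_mx !subrr.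
have nb := normr_ge0 (b - mul (inv x) z).
by rewrite !norm_row_mx ?normr0.
Qed.

(** Von Neumann's characterization of the mean value of an almost periodic function. *)
Definition near_const f c := forall d : R, 0 < d ->
  exists2 A, ingrp A & forall x, inG x -> `|avg A f x - c| <= d.

(* Take the infimum s of the maxima of all averages of f: if an average is
   close to optimal and drops below s somewhere, averaging it further over a
   fine net would push its maximum below s. *)
Lemma near_const_ex f : polyfun f -> exists c, near_const f c.
Proof.
move=> pf; have [B _ hB] := rag_bounded; have [C _ hC] := polyfun_bounded B pf.
pose S := [set c | exists2 A, ingrp A & forall x, inG x -> avg A f x <= c].
have Ge : inG e := rag_e_in G.
have ie : ingrp [:: e] by split=> // a; rewrite inE => /eqP ->.
have iS : has_inf S.
  split.
    exists C; exists [:: e] => // x Gx; apply: avg_le => // y Gy.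
    exact: le_trans (ler_norm _) (hC _ (hB _ Gy)).
  exists (- C) => c [A GA hA]; apply: le_trans (hA _ Ge).
  rewrite lerNl -mulN1r -avgZ; apply: avg_le => // y Gy; rewrite mulN1r.
  by apply: le_trans (ler_norm _) _; rewrite normrN hC ?hB.
exists (inf S) => d d0.
have d20 : 0 < d / 2 by rewrite divr_gt0.
have [L GL hL] := equicontinuous_net pf d20; have [L0 inL] := GL.
set l : R := (size L)%:R; have l0 : 0 < l by rewrite ltr0n.
have l1 : 1 <= l by rewrite ler1n.
have dl0 : 0 < d / 2 / l by rewrite divr_gt0.
have [c [A GA hA] cS] := inf_adherent dl0 iS.
have dl : d / 2 / l <= d / 2 by rewrite ler_pdivrMr// ler_peMr// ltW.
exists A => // z Gz; rewrite ler_norml; apply/andP; split; last first.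
  have := hA z Gz; lra.
(* At every x, one of the l translates x b has an A-average at most d / 2 above the one at z, and
   the others are at most c. Since c exceeds the infimum by less than d / 2 / l, this forces the
   average at z up to within d of it. *)
have : inf S <= c + (avg A f z + d / 2 - c) / l.
  apply: ge_inf; first exact: iS.2.
  exists (mulseq L A) => [|x Gx]; first exact: ingrp_mulseq.
  rewrite avg_mulseq//; have [b bL hb] := hL x z Gx Gz.
  rewrite -[X in avg L X](_ : (fun y => c + (avg A f y - c)) = _); last first.
    by apply/funext => y; rewrite addrC subrK.
  rewrite avgD avg_cst// lerD2l /avg ler_pM2r ?invr_gt0//.
  rewrite (big_rem _ bL) /= -[leRHS]addr0 lerD//.
    rewrite lerD2r -lerBlDl /avg -mulrBl -sumrB.
    rewrite ler_pdivrMr ?ltr0n//; last by case: GA.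
    rewrite mulrC; apply: sum_seq_le => a aA.
    by apply: le_trans (ler_norm _) (hb _ _); case: GA => _; apply.
  rewrite (le_trans (@sum_seq_le _ _ (rem b L) _ 0 _)) ?mulr0// => a /mem_rem aL.
  by rewrite subr_le0 hA//; apply: rag_mul_in => //; exact: inL.
rewrite -lerBlDl ler_pdivlMr//.
have h1 : (inf S - c) * l >= - (d / 2).
  rewrite -ler_pdivrMr// mulNr; lra.
have := hA z Gz; have := ge_inf iS.2 (ex_intro2 _ _ A GA hA : S c).
lra.
Qed.

(** Inversion exchanges left and right translations. Left averages are wanted because they commute
    with right ones, which gives uniqueness. *)
Lemma left_const_ex f : polyfun f -> exists c : R, forall d : R, 0 < d ->
  exists2 A, ingrp A &
    forall x, inG x -> `|(\sum_(a <- A) f (mul a x)) / (size A)%:R - c| <= d.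
Proof.
move=> pf; have [c hc] : exists c, near_const (fun x => f (inv x)) c.
  by apply: near_const_ex; exact: (polyfun_comp pf (polyfunv_inv (@polyfunv_id R m))).
exists c => d /hc[A [A0 GA] hA]; exists [seq inv a | a <- A].
  split; first by rewrite size_map.
  by move=> _ /mapP[a aA ->]; apply: rag_inv_in; exact: GA.
move=> x Gx; rewrite size_map big_map.
have := hA _ (rag_inv_in Gx);
rewrite /avg (_ : \sum_(a <- A) _ = \sum_(a <- A) f (mul (inv a) x))//.
apply: eq_big_seq => a aA; have Ga := GA a aA.
by rewrite (rag_invM (rag_inv_in Gx))// rag_invK.
Qed.

(** Average on the left over B and on the right over A: in one order of summation the double average
    is close to the left constant k, in the other to c. So every right constant equals k. *)
Lemma near_const_uniq f c c' : polyfun f -> near_const f c -> near_const f c' -> c = c'.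
Proof.
move=> /left_const_ex[k hk]; suff h : forall c, near_const f c -> c = k.
  by move=> /h -> /h ->.
move=> {}c hc; apply/eqP; rewrite -subr_eq0 -normr_le0; apply/ler_addgt0Pl => d d0.
have d20 : 0 < d / 2 by rewrite divr_gt0.
have [A GA hA] := hc _ d20; have [B GB hB] := hk _ d20.
have [A0 inA] := GA; have [B0 inB] := GB.
pose s := (\sum_(b <- B) avg A f b) / (size B)%:R.
have sE : s = avg A (fun x => (\sum_(b <- B) f (mul b x)) / (size B)%:R) e.
  rewrite /s /avg -!mulr_suml mulrAC exchange_big /=; congr (_ / _ / _).
  apply: eq_big_seq => a aA; apply: eq_big_seq => b bB.
  by rewrite rag_mul1g//; exact: inA.
have h1 : `|s - k| <= d / 2.
  by rewrite sE; apply: avg_norm_le => //; exact: rag_e_in.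
have h2 : `|s - c| <= d / 2.
  have -> : s - c = (\sum_(b <- B) (avg A f b - c)) / (size B)%:R.
    rewrite sumrB mulrBl big_const_seq count_predT iter_addr_0 -[c *+ _]mulr_natr mulfK//.
    by rewrite pnatr_eq0 -lt0n.
  rewrite normrM normfV normr_nat ler_pdivrMr ?ltr0n// mulrC.
  rewrite (le_trans (ler_norm_sum _ _ _))//; apply: sum_seq_le => b bB.
  by apply: hA; exact: inB.
rewrite addr0 (_ : c - k = (s - k) - (s - c)); last by ring.
rewrite (le_trans (ler_normB _ _))//; lra.
Qed.

(* The integral of a polynomial function against the Haar probability of G. *)
Definition mean f : R := xget 0 [set c | near_const f c].

Lemma meanP f : polyfun f -> near_const f (mean f).
Proof.
by move=> /near_const_ex hc; exact: (xgetPex 0 hc).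
Qed.

Lemma mean_eq f c : polyfun f -> near_const f c -> mean f = c.
Proof. by move=> pf; exact: (near_const_uniq pf (meanP pf)). Qed.

Lemma mean_avg A f : ingrp A -> polyfun f -> mean (avg A f) = mean f.
Proof.
move=> GA pf; apply/esym/mean_eq => // d d0.
have [B GB hB] := meanP (polyfun_avg A pf) d0.
by exists (mulseq B A) => [|x Gx]; [exact: ingrp_mulseq|rewrite avg_mulseq ?hB].
Qed.

Lemma meanD f g : polyfun f -> polyfun g -> mean (fun x => f x + g x) = mean f + mean g.
Proof.
move=> pf pg; apply: mean_eq => [|d d0]; first exact: polyfunD.
have d20 : 0 < d / 2 by rewrite divr_gt0.
(* B is chosen for the A-average of g: further averaging over B leaves the A-average of f close to
   its constant, so [mulseq B A] suits both functions. *)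
have [A GA hA] := meanP pf d20; have [B GB hB] := meanP (polyfun_avg A pg) d20.
exists (mulseq B A) => [|x Gx]; first exact: ingrp_mulseq.
rewrite avg_mulseq// (_ : avg A (fun y => f y + g y) = fun y => avg A f y + avg A g y).
  rewrite avgD opprD addrACA (le_trans (ler_normD _ _))//.
  have h1 : `|avg B (avg A f) x - mean f| <= d / 2 by exact: avg_norm_le.
  by have := hB x Gx; rewrite mean_avg//; lra.
by apply/funext => y; rewrite avgD.
Qed.

Lemma meanZ k f : polyfun f -> mean (fun x => k * f x) = k * mean f.
Proof.
move=> pf; apply: mean_eq => [|d d0]; first by apply: polyfunM => //; exact: polyfun_cst.
have k0 : 0 < `|k| + 1 by rewrite ltr_wpDl.
have [A GA hA] := meanP pf (divr_gt0 d0 k0).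
exists A => // x Gx; rewrite avgZ -mulrBr normrM.
apply: le_trans (_ : (`|k| + 1) * (d / (`|k| + 1)) <= _); last by rewrite mulrC divfK// gt_eqF.
by apply: ler_pM => //; [rewrite lerDl|exact: hA].
Qed.

Lemma meanB f g : polyfun f -> polyfun g -> mean (fun x => f x - g x) = mean f - mean g.
Proof.
move=> pf pg; rewrite -mulN1r -meanZ// -meanD//; last first.
  by apply: polyfunM => //; exact: polyfun_cst.
by congr mean; apply/funext => x; rewrite mulN1r.
Qed.

Lemma mean_cst c : mean (fun=> c) = c.
Proof.
apply: mean_eq => [|d d0]; first exact: polyfun_cst.
exists [:: e] => [|x Gx]; first by split=> // a; rewrite inE => /eqP ->; exact: rag_e_in.
rewrite avg_cst ?subrr ?normr0 ?ltW//.
by split=> // a; rewrite inE => /eqP ->; exact: rag_e_in.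
Qed.

Lemma mean_sum (I : Type) (s : seq I) (f : I -> 'rV[R]_m -> R) :
  (forall i, polyfun (f i)) ->
  mean (fun x => \sum_(i <- s) f i x) = \sum_(i <- s) mean (f i).
Proof.
move=> pf; elim: s => [|i s IH].
  by rewrite big_nil -[RHS](mean_cst 0); congr mean; apply/funext => x; rewrite big_nil.
rewrite big_cons -IH -meanD//; last exact: polyfun_sum.
by congr mean; apply/funext => x; rewrite big_cons.
Qed.

Lemma mean_ge0 f : polyfun f -> (forall x, inG x -> 0 <= f x) -> 0 <= mean f.
Proof.
move=> pf f0; apply/ler_addgt0Pl => d d0; have [A GA hA] := meanP pf d0.
have := hA _ (rag_e_in G); rewrite ler_norml => /andP[_].
have : 0 <= avg A f e.
  rewrite -oppr_le0 -mulN1r -avgZ; apply: avg_le => //; first exact: rag_e_in.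
  by move=> y Gy; rewrite mulN1r oppr_le0 f0.
lra.
Qed.

Lemma ler_mean f g : polyfun f -> polyfun g -> (forall x, inG x -> f x <= g x) ->
  mean f <= mean g.
Proof.
move=> pf pg h; rewrite -subr_ge0 -meanB//; apply: mean_ge0 => [|x Gx].
  exact: polyfunB.
by rewrite subr_ge0 h.
Qed.

Lemma eq_mean f g : polyfun f -> polyfun g -> (forall x, inG x -> f x = g x) ->
  mean f = mean g.
Proof.
by move=> pf pg h; apply/eqP; rewrite eq_le !ler_mean// => x Gx; rewrite h.
Qed.

Lemma mean_norm_le f c : polyfun f -> (forall x, inG x -> `|f x| <= c) -> `|mean f| <= c.
Proof.
move=> pf h; rewrite ler_norml; apply/andP; split.
  rewrite -(mean_cst (- c)); apply: ler_mean => // [|x Gx]; first exact: polyfun_cst.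
  by have := h x Gx; rewrite ler_norml => /andP[].
rewrite -(mean_cst c); apply: ler_mean => // [|x Gx]; first exact: polyfun_cst.
by rewrite (le_trans (ler_norm _)) ?h.
Qed.

Lemma mean_mulr f h : polyfun f -> inG h -> mean (fun x => f (mul x h)) = mean f.
Proof.
move=> pf Gh; rewrite -[RHS](@mean_avg [:: h])//; last first.
  by split=> // a; rewrite inE => /eqP ->.
by congr mean; apply/funext => x; rewrite /avg big_seq1 divr1.
Qed.

End InvariantMean.

(** * Means with parameters and concentration of means of powers *)

Section Averaging.
Variables (R : realType) (m : nat) (G : realAlgGroup R m).
Hypothesis Gcompact : compact (G : set 'rV[R]_m).

Local Notation mul := (rag_mul G).
Local Notation inv := (rag_inv G).
Local Notation e := (rag_e G).
Local Notation inG x := (rag_set G x).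
Local Notation mean := (mean G).

Lemma polyfun_row n (F : 'rV[R]_(m + n) -> R) x :
  polyfun F -> polyfun (fun g => F (row_mx g x)).
Proof.
move=> pF; apply: (polyfun_comp pF); apply: polyfunv_row; first exact: polyfunv_id.
exact: polyfunv_cst.
Qed.

(** Separating the variables, F(g, x) is a finite sum of products a_i(g) b_i(x), and the mean acts
    on the a_i alone. *)
Lemma polyfun_mean n (F : 'rV[R]_(m + n) -> R) :
  polyfun F -> polyfun (fun x => mean (fun g => F (row_mx g x))).
Proof.
move=> pF; suff [I [a [b [pa pb FE]]]] : exists (I : finType)
    (a : I -> 'rV[R]_m -> R) (b : I -> 'rV[R]_n -> R),
    [/\ forall i, polyfun (a i), forall i, polyfun (b i) &
        forall g x, F (row_mx g x) = \sum_i a i g * b i x].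
  have H : polyfun (fun x => \sum_i mean (a i) * b i x).
    by apply: polyfun_sum => i; apply: polyfunM; [exact: polyfun_cst|].
  apply: eq_polyfun H => x.
  rewrite (_ : (fun g => _) = fun g => \sum_i b i x * a i g); last first.
    by apply/funext => g; rewrite FE; apply: eq_bigr => i _; rewrite mulrC.
  rewrite mean_sum//; last by move=> i; apply: polyfunM; [exact: polyfun_cst|].
  by apply: eq_bigr => i _; rewrite meanZ// mulrC.
elim/polyfun_ind: pF => [c|i|f1 f2 [I [a [b [pa pb h]]]] [J [a' [b' [pa' pb' h']]]]
    |f1 f2 [I [a [b [pa pb h]]]] [J [a' [b' [pa' pb' h']]]]].
- exists unit, (fun _ _ => c), (fun _ _ => 1); split=> [_|_|g x]; try exact: polyfun_cst.
  by rewrite (big_pred1 tt) ?mulr1// => -[].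
- have [j ->|j ->] := fintype.split_ordP i.
    exists unit, (fun _ x => x ord0 j), (fun _ _ => 1).
    split=> [_|_|g x]; [exact: polyfun_coord|exact: polyfun_cst|].
    by rewrite row_mxEl (big_pred1 tt) ?mulr1// => -[].
  exists unit, (fun _ _ => 1), (fun _ x => x ord0 j).
  split=> [_|_|g x]; [exact: polyfun_cst|exact: polyfun_coord|].
  by rewrite row_mxEr (big_pred1 tt) ?mul1r// => -[].
- exists (I + J)%type, (fun i => match i with inl i => a i | inr j => a' j end),
    (fun i => match i with inl i => b i | inr j => b' j end).
  by split=> [[]|[]|g x]//; rewrite big_sumType h h'.
- exists (I * J)%type, (fun ij x => a ij.1 x * a' ij.2 x),
    (fun ij x => b ij.1 x * b' ij.2 x).
  split=> [i|i|g x]; try exact: polyfunM.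
  rewrite h h' big_distrlr pair_bigA; apply: eq_bigr => -[i j] _ /=; ring.
Qed.

(** The point is that M does not depend on k. Near e the function w exceeds c, and a finite net
    translates every x into that region; M is the size of the net and stands for the inverse of the
    measure of the region. *)
Lemma mean_expn_ge w (d : R) : polyfun w -> (forall g, inG g -> 0 <= w g) -> 0 < d ->
  exists2 M : R, 0 < M & forall (k : nat) (c : R), 0 <= c -> c + d <= w e ->
    c ^+ k <= M * mean (fun g => w g ^+ k).
Proof.
move=> pw w0 d0; have [L [L0 inL] hL] := equicontinuous_net Gcompact pw d0.
have l0 : 0 < (size L)%:R :> R by rewrite ltr0n.
exists (size L)%:R => // k c c0 cw.
have pwk := polyfunX k pw.
rewrite mulrC -ler_pdivrMr// -(mean_avg Gcompact (conj L0 inL))//.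
rewrite -(mean_cst Gcompact (_ / _)); apply: ler_mean => // [||x Gx].
- exact: polyfun_cst.
- exact: polyfun_avg.
have [b bL /(_ e (rag_e_in G))] := hL x e Gx (rag_e_in G).
have Gb := inL b bL; have Gxb := rag_mul_in Gx Gb.
rewrite rag_mulg1// rag_mul1g ?ler_norml; last exact: rag_e_in.
move=> /andP[h _]; rewrite /avg ler_pM2r ?invr_gt0// (big_rem _ bL) /=.
apply: le_trans (_ : w (mul x b) ^+ k <= _).
  by rewrite lerXn2r ?nnegrE// ?w0//; lra.
rewrite lerDl big_seq; apply: sumr_ge0 => a /mem_rem aL.
by rewrite exprn_ge0// w0//; apply: rag_mul_in => //; exact: inL.
Qed.

Lemma mean_gt0 w : polyfun w -> (forall g, inG g -> 0 <= w g) -> 0 < w e -> 0 < mean w.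
Proof.
move=> pw w0 we0; have d0 : 0 < w e / 2 by rewrite divr_gt0.
have [M M0 /(_ 1%N _ (ltW d0))] := mean_expn_ge pw w0 d0.
rewrite expr1 => h; have {h} : w e / 2 <= M * mean w by apply: h; lra.
by move=> /(lt_le_trans d0); rewrite pmulr_rgt0.
Qed.

Lemma exprn_dominates (b c M : R) : 0 <= b -> b < c -> exists k, M * b ^+ k < c ^+ k.
Proof.
move=> b0 bc; have c0 : 0 < c := le_lt_trans b0 bc.
have bc1 : `|b / c| < 1 by rewrite (ger0_norm (divr_ge0 b0 (ltW c0))) ltr_pdivrMr// mul1r.
have M0 : 0 < `|M| + 1 by rewrite ltr_wpDl.
have /cvgrPdist_lt /(_ (`|M| + 1)^-1) := cvg_expr bc1.
rewrite invr_gt0 => /(_ M0)[k _ /(_ k (leqnn k))] /=.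
rewrite sub0r normrN normrX (ger0_norm (divr_ge0 b0 (ltW c0))) => h; exists k.
have : M * b ^+ k <= (`|M| + 1) * b ^+ k.
  by rewrite ler_wpM2r ?exprn_ge0// (le_trans (ler_norm M))// lerDl.
move=> /le_lt_trans; apply; rewrite mulrC -ltr_pdivlMr// mulrC.
by rewrite -ltr_pdivrMr ?exprn_gt0// -expr_div_n.
Qed.

(** The weights w^k concentrate at e, the only maximum of w. If f(e) were positive, the mean of w^k
    f would be positive for large k; the opposite sign follows with -f. *)
Lemma mean_concentration w f : polyfun w -> polyfun f ->
  (forall g, inG g -> 0 <= w g) -> (forall g, inG g -> g <> e -> w g < w e) ->
  (forall k, mean (fun g => w g ^+ k * f g) = 0) -> f e = 0.
Proof.
move=> pw pf w0 we; suff h f' : polyfun f' ->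
    (forall k, mean (fun g => w g ^+ k * f' g) = 0) -> f' e <= 0.
  move=> fk; apply/eqP; rewrite eq_le h//= -oppr_le0.
  rewrite -mulN1r (h (fun x => -1 * f x))//.
    by apply: polyfunM => //; exact: polyfun_cst.
  move=> k; rewrite (_ : (fun g => _) = fun g => -1 * (w g ^+ k * f g)).
    by rewrite meanZ// ?fk ?mulr0//; apply: polyfunM => //; exact: polyfunX.
  by apply/funext => g; rewrite mulrCA.
move=> {f pf} pf fk; set f := f' in pf fk *; rewrite leNgt; apply/negP => fe.
have Ge := rag_e_in G.
(* The compact set where f may spoil positivity. It avoids e, so the maximum b of w on it is smaller
   than w(e). If it is empty, k = 0 already gives a contradiction. *)
pose A := [set g | inG g /\ f g <= f e / 2].
have Ac : compact A.
  apply: compact_closedI => //; apply: (@closed_comp _ _ f [set x | x <= f e / 2]).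
    by move=> x _; exact: polyfun_continuous.
  exact: closed_le.
have fe2 : 0 < f e / 2 by rewrite divr_gt0.
have pwk k : polyfun (fun g => w g ^+ k) := polyfunX k pw.
have [[g0 Ag0]|A0] := pselect (A !=set0); last first.
  have := fk 0%N; apply/eqP; rewrite gt_eqF//; apply: lt_le_trans fe2 _.
  rewrite -(mean_cst Gcompact (_ / _)); apply: ler_mean => // [||g Gg].
  - exact: polyfun_cst.
  - exact: polyfunM.
  rewrite expr0 mul1r leNgt; apply/negP => fg.
  by apply: A0; exists g; split => //; exact: ltW.
have pNw : polyfun (fun g => -1 * w g) by apply: polyfunM => //; exact: polyfun_cst.
have [g1 [Gg1 fg1] hg1] := compact_polyfun_min Ac (ex_intro _ g0 Ag0) pNw.
have g1e : w g1 < w e by apply: we => // g1e; move: fg1; rewrite g1e; lra.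
have [B _ hB] := rag_bounded Gcompact; have [C C0 hC] := polyfun_bounded B pf.
set b := w g1; have b0 : 0 <= b := w0 _ Gg1.
have d0 : 0 < (w e - b) / 2 by rewrite divr_gt0// subr_gt0.
have [M M0 hM] := mean_expn_ge pw w0 d0.
have c0 : b < (w e + b) / 2 by rewrite -/b in g1e; lra.
(* On all of G, w^k f >= w^k f(e)/2 - (C + f(e)/2) b^k. As the mean of the left-hand side is 0, the
   mean of w^k is at most the stated multiple of b^k, while [mean_expn_ge] bounds it below by c^k /
   M with c halfway between b and w(e). *)
have [k] := exprn_dominates (M * ((C + f e / 2) / (f e / 2))) b0 c0.
apply/negP; rewrite -leNgt.
have cw : (w e + b) / 2 + (w e - b) / 2 <= w e by lra.
apply: le_trans (hM k _ (le_trans b0 (ltW c0)) cw) _.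
rewrite -mulrA ler_pM2l// mulrAC ler_pdivlMr// mulrC -subr_le0 -(fk k).
rewrite -meanZ// -(mean_cst Gcompact (_ * b ^+ k)) -meanB//; first last.
- exact: polyfun_cst.
- by apply: polyfunM => //; exact: polyfun_cst.
apply: ler_mean => // [||g Gg].
- by apply: polyfunB; [apply: polyfunM => //|]; exact: polyfun_cst.
- exact: polyfunM.
have wk0 : 0 <= w g ^+ k by rewrite exprn_ge0// w0.
have Cf : 0 <= C + f e / 2 by rewrite addr_ge0// ltW.
have [fg|fg] := leP (f g) (f e / 2).
  have : - C <= f g by have := hC g (hB g Gg); rewrite ler_norml => /andP[].
  have : w g ^+ k <= b ^+ k.
    rewrite lerXn2r ?nnegrE ?w0//.
    by have := hg1 g (conj Gg fg); rewrite !mulN1r lerN2.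
  move=> /(ler_wpM2l Cf) h1 /(ler_wpM2l wk0) h2.
  by rewrite lerBlDr; nra.
have : w g ^+ k * (f e / 2) <= w g ^+ k * f g by rewrite ler_wpM2l// ltW.
have : 0 <= (C + f e / 2) * b ^+ k by rewrite mulr_ge0// exprn_ge0.
lra.
Qed.

End Averaging.

(** * The invariant distance *)

Section InvariantDistance.
Variables (R : realType) (m : nat) (G : realAlgGroup R m).
Hypothesis Gcompact : compact (G : set 'rV[R]_m).
Variables (n : nat) (X : polyGset G n).

Local Notation mul := (rag_mul G).
Local Notation inv := (rag_inv G).
Local Notation e := (rag_e G).
Local Notation inG x := (rag_set G x).
Local Notation mean := (mean G).
Local Notation act := (pg_act X).
Local Notation inX x := (pg_set X x).

Lemma polyfunv_act k (f : 'rV[R]_k -> 'rV[R]_m) (g : 'rV[R]_k -> 'rV[R]_n) :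
  polyfunv f -> polyfunv g -> polyfunv (fun x => act (f x) (g x)).
Proof.
by move=> pf pg; exact: (polyfunv_comp (@polyfunv_pmeval _ _ _ _) (polyfunv_row pf pg)).
Qed.

Lemma polyfunv_actl x : polyfunv (fun g => act g x).
Proof. by apply: polyfunv_act; [exact: polyfunv_id|exact: polyfunv_cst]. Qed.

Lemma polyfun_actl (f : 'rV[R]_n -> R) x : polyfun f -> polyfun (fun g => f (act g x)).
Proof. by move=> pf; exact: (polyfun_comp pf (polyfunv_actl x)). Qed.

Lemma actVK g x : inG g -> inX x -> act (inv g) (act g x) = x.
Proof.
by move=> Gg Xx; rewrite -pg_actM ?rag_mulVg ?pg_act1//; exact: rag_inv_in.
Qed.

Lemma actKV g x : inG g -> inX x -> act g (act (inv g) x) = x.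
Proof.
by move=> Gg Xx; rewrite -pg_actM ?rag_mulgV ?pg_act1//; exact: rag_inv_in.
Qed.

(** Invariance is confined to X, where [act] is an action, but the formula for p holds on all of
    R^n. Differentials at x0 in arbitrary directions are computed from it. *)
Lemma reynolds f : polyfun f -> exists2 p, invariant_on X p &
  forall x, peval p x = mean (fun g => f (act g x)).
Proof.
move=> pf; have [p pE] : polyfun (fun x => mean (fun g => f (act g x))).
  pose F (w : 'rV[R]_(m + n)) := f (act (lsubmx w) (rsubmx w)).
  have pF : polyfun F.
    by apply: (polyfun_comp pf); apply: polyfunv_act;
      [exact: polyfunv_l|exact: polyfunv_r].
  apply: eq_polyfun (polyfun_mean Gcompact pF) => x; congr mean; apply/funext => g.
  by rewrite /F row_mxKl row_mxKr.
exists p => [h x Gh Xx|x]; rewrite -!pE//.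
rewrite -(mean_mulr Gcompact (polyfun_actl x pf) Gh).
apply: (eq_mean Gcompact) => [||g Gg]; last by rewrite pg_actM.
  exact: polyfun_actl.
apply: (polyfun_comp (polyfun_actl x pf)).
by apply: polyfunv_mul; [exact: polyfunv_id|exact: polyfunv_cst].
Qed.

Definition nsq (v : 'rV[R]_n) : R := \sum_i v ord0 i ^+ 2.

Lemma nsq_ge0 v : 0 <= nsq v.
Proof. by apply: sumr_ge0 => i _; exact: sqr_ge0. Qed.

Lemma nsq_gt0 v : v != 0 -> 0 < nsq v.
Proof.
move=> v0; rewrite lt_def nsq_ge0 andbT; apply: contra v0 => /eqP/psumr_eq0P h.
apply/eqP/rowP => i; rewrite mxE; apply/eqP; rewrite -sqrf_eq0 h// => j _.
exact: sqr_ge0.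
Qed.

Lemma nsqN v : nsq (- v) = nsq v.
Proof. by apply: eq_bigr => i _; rewrite mxE sqrrN. Qed.

Lemma norm_nsq v : `|v| ^+ 2 <= nsq v.
Proof.
rewrite -[leRHS]sqr_sqrtr ?nsq_ge0// lerXn2r ?nnegrE ?sqrtr_ge0//.
apply: norm_row_le => [|i]; first exact: sqrtr_ge0.
rewrite -sqrtr_sqr ler_wsqrtr// /nsq (bigD1 i)//= lerDl.
by apply: sumr_ge0 => j _; exact: sqr_ge0.
Qed.

Lemma nsqB_le v w : nsq (v - w) <= 2 * nsq v + 2 * nsq w.
Proof.
rewrite /nsq !mulr_sumr -big_split; apply: ler_sum => i _; rewrite !mxE /=.
rewrite -subr_ge0 (_ : _ - _ = (v ord0 i + w ord0 i) ^+ 2) ?sqr_ge0//; ring.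
Qed.

Lemma polyfun_nsq k (f : 'rV[R]_k -> 'rV[R]_n) : polyfunv f -> polyfun (fun x => nsq (f x)).
Proof. by move=> pf; apply: polyfun_sum => i; exact: polyfunX. Qed.

Definition idist x y : R := mean (fun g => nsq (act g x - act g y)).

Lemma polyfun_idist y : polyfun (idist^~ y).
Proof.
pose F (w : 'rV[R]_(m + n)) := nsq (act (lsubmx w) (rsubmx w) - act (lsubmx w) y).
have pF : polyfun F.
  apply: polyfun_nsq; apply: polyfunvB; apply: polyfunv_act; try exact: polyfunv_l.
    exact: polyfunv_r.
  exact: polyfunv_cst.
apply: eq_polyfun (polyfun_mean Gcompact pF) => x; congr mean; apply/funext => g.
by rewrite /F row_mxKl row_mxKr.
Qed.

Lemma polyfun_nsqactB x y : polyfun (fun g => nsq (act g x - act g y)).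
Proof. by apply: polyfun_nsq; apply: polyfunvB; exact: polyfunv_actl. Qed.

Lemma idistC x y : idist x y = idist y x.
Proof. by congr mean; apply/funext => g; rewrite -nsqN opprB. Qed.

Lemma idistxx x : idist x x = 0.
Proof.
rewrite /idist (_ : (fun g => _) = fun=> 0) ?mean_cst//; apply/funext => g.
by rewrite subrr /nsq big1// => i _; rewrite mxE expr0n.
Qed.

Lemma idist_gt0 x y : inX x -> inX y -> x != y -> 0 < idist x y.
Proof.
move=> Xx Xy xy; apply: mean_gt0 => // [|g _|]; first exact: polyfun_nsqactB.
  exact: nsq_ge0.
by rewrite !pg_act1// nsq_gt0// subr_eq0.
Qed.

Lemma idist_act h x y : inG h -> inX x -> inX y ->
  idist (act h x) (act h y) = idist x y.
Proof.
move=> Gh Xx Xy; rewrite /idist -[RHS](mean_mulr Gcompact (polyfun_nsqactB x y) Gh).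
apply: (eq_mean Gcompact) => [||g Gg]; last by rewrite !pg_actM.
  exact: polyfun_nsqactB.
apply: (polyfun_comp (polyfun_nsqactB x y)).
by apply: polyfunv_mul; [exact: polyfunv_id|exact: polyfunv_cst].
Qed.

(** If the mean of |g z - g x0|^2 is small, then g z is close to g x0 for some g, and g^-1 brings
    both back with a Lipschitz constant uniform over G. *)
Lemma idist_small x0 d : inX x0 -> 0 < d ->
  exists2 c : R, 0 < c & forall z, inX z -> idist z x0 < c -> `|z - x0| < d.
Proof.
move=> Xx0 d0; have [B B0 hB] := rag_bounded Gcompact.
have [C C0 hC] := polyfunv_bounded B (polyfunv_actl x0).
have pa : polyfunv (fun w : 'rV[R]_(m + n) => act (lsubmx w) (rsubmx w)).
  by apply: polyfunv_act; [exact: polyfunv_l|exact: polyfunv_r].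
have [K K0 hK] := polyfunv_lipschitz (B + (C + 1)) pa.
have c0 : 0 < Num.min 1 (d / K) by rewrite lt_min ltr01 divr_gt0.
(* The bound 1 keeps g z in the ball on which K is a Lipschitz constant; the square is there because
   [idist] is a mean of squares. *)
exists (Num.min 1 (d / K) ^+ 2) => [|z Xz Dz]; first by rewrite exprn_gt0.
have [g Gg hg] : exists2 g, inG g & nsq (act g z - act g x0) < Num.min 1 (d / K) ^+ 2.
  apply: contrapT => h; move: Dz; apply/negP; rewrite -leNgt.
  rewrite -(mean_cst Gcompact (_ ^+ 2)); apply: ler_mean => // [||g Gg].
  - exact: polyfun_cst.
  - exact: polyfun_nsqactB.
  by rewrite leNgt; apply/negP => hg; apply: h; exists g.
have : `|act g z - act g x0| < Num.min 1 (d / K).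
  have := le_lt_trans (norm_nsq _) hg.
  by rewrite ltr_pXn2r ?nnegrE// ltW.
rewrite lt_min => /andP[h1 h2]; have Gg' := rag_inv_in Gg.
have nx0 : `|act g x0| <= C by exact/hC/hB.
have nz : `|act g z| <= C + 1.
  rewrite -(subrK (act g x0) (act g z)) (le_trans (ler_normD _ _))//.
  by rewrite addrC lerD// ltW.
rewrite -(actVK Gg Xz) -(actVK Gg Xx0).
have w1 : `|row_mx (inv g) (act g z)| <= B + (C + 1).
  by apply: norm_row_mx; [rewrite (le_trans (hB _ Gg'))// lerDl addr_ge0|
    rewrite (le_trans nz)// lerDr ltW].
have w2 : `|row_mx (inv g) (act g x0)| <= B + (C + 1).
  apply: norm_row_mx; first by rewrite (le_trans (hB _ Gg'))// lerDl addr_ge0.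
  by rewrite (le_trans nx0)// addrCA lerDl addr_ge0// ltW.
have := hK _ _ w1 w2; rewrite !row_mxKl !row_mxKr => /le_lt_trans; apply.
rewrite mulrC -ltr_pdivlMr//; apply: le_lt_trans h2.
by rewrite opp_row_mx add_row_mx subrr norm_row_mx ?normr0.
Qed.

Variables (r : nat) (F : polymap R n r).
Hypothesis quotF : geometric_quotient X F.

Lemma invariant_near x0 p d : inX x0 -> invariant_on X p -> 0 < d ->
  exists2 c : R, 0 < c & forall z, inX z -> `|pmeval F z - pmeval F x0| < c ->
    `|peval p z - peval p x0| < d.
Proof.
move=> Xx0 /(proj2 quotF)[q pE] d0.
have [L L0 hL] := polyfun_lipschitz (`|pmeval F x0| + 1) (polyfun_peval q).
exists (Num.min 1 (d / L)) => [|z Xz]; first by rewrite lt_min ltr01 divr_gt0.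
rewrite lt_min => /andP[h1 h2]; rewrite !pE//.
apply: le_lt_trans (hL _ _ _ _) _.
- rewrite -(subrK (pmeval F x0) (pmeval F z)) (le_trans (ler_normD _ _))//.
  by rewrite addrC lerD2l ltW.
- by rewrite lerDl.
- by rewrite mulrC -ltr_pdivlMr.
Qed.

(** An orbit whose image is close to that of x0 comes close to x0. The invariant obtained by
    averaging (rho - d(g x, x0))^k exceeds (rho - d)^k at x0 for large k, since the orbit of x0
    passes through the peak; on an orbit that stays at distance at least d it does not. Invariants
    are polynomials in F, so closeness of the images excludes the second case. *)
Lemma idist_proper x0 d : inX x0 -> 0 < d ->
  exists2 c : R, 0 < c & forall z, inX z -> `|pmeval F z - pmeval F x0| < c ->
    exists2 g, inG g & idist (act g z) x0 < d.
Proof.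
move=> Xx0 d0; pose N x := mean (fun g => nsq (act g x)).
have pn : polyfun nsq by exact: (polyfun_nsq (@polyfunv_id _ _)).
have [pN iN NE] := reynolds pn.
have N0 x : 0 <= N x.
  by apply: mean_ge0 => // [|g _]; [exact: polyfun_actl|exact: nsq_ge0].
have DN z g : inX z -> inG g -> idist (act g z) x0 <= 2 * N z + 2 * N x0.
  move=> Xz Gg; have <- : N (act g z) = N z by rewrite /N -!NE iN.
  have pm k x : polyfun (fun g => k * nsq (act g x)).
    by apply: polyfunM; [exact: polyfun_cst|exact: polyfun_actl].
  rewrite /N -!meanZ//; try exact: polyfun_actl.
  rewrite -meanD//; apply: ler_mean => // [||h Gh]; last exact: nsqB_le.
    exact: polyfun_nsqactB.
  exact: polyfunD.
(* When N z <= N x0 + 1, the distance from g z to x0 is at most 2 N z + 2 N x0 <= 4 N x0 + 2, so the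
   base of the power is nonnegative on the orbit; the summand d makes rho - d nonnegative too. *)
set rho : R := 4 * N x0 + 2 + d.
have pW : polyfun (fun x => rho - idist x x0).
  by apply: polyfunB; [exact: polyfun_cst|exact: polyfun_idist].
have rhoD : d <= rho by rewrite lerDr addr_ge0// mulr_ge0.
have W0 z g : inX z -> N z <= N x0 + 1 -> inG g -> 0 <= rho - idist (act g z) x0.
  by move=> Xz Nz Gg; have := DN z g Xz Gg; rewrite /rho; lra.
have [|M M0 hM] := mean_expn_ge Gcompact (polyfun_actl x0 pW) _ (divr_gt0 d0 (ltr0n _ 2)).
  by move=> g Gg; apply: W0 => //; rewrite lerDl.
have [k kM] : exists k, M * (rho - d) ^+ k < (rho - d / 2) ^+ k.
  by apply: exprn_dominates; [rewrite subr_ge0|lra].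
have [p ip pE] := reynolds (polyfunX k pW).
have Mp : (rho - d) ^+ k < peval p x0.
  rewrite pE -(ltr_pM2l M0); apply: (lt_le_trans kM); apply: hM; first lra.
  by rewrite pg_act1// idistxx; lra.
have p0 : 0 < peval p x0 - (rho - d) ^+ k by rewrite subr_gt0.
have [c1 c10 h1] := invariant_near Xx0 iN ltr01.
have [c2 c20 h2] := invariant_near Xx0 ip p0.
exists (Num.min c1 c2) => [|z Xz]; first by rewrite lt_min c10.
rewrite lt_min => /andP[/(h1 _ Xz) Nz /(h2 _ Xz) pz].
have {}Nz : N z <= N x0 + 1.
  by move: Nz; rewrite !NE ltr_norml => /andP[_]; rewrite -/(N z) -/(N x0); lra.
apply: contrapT => hg; move: pz; apply/negP; rewrite -leNgt.
suff : peval p z <= (rho - d) ^+ k.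
  by move=> h; rewrite -normrN (le_trans _ (ler_norm _))// opprB lerB.
rewrite pE -(mean_cst Gcompact (_ ^+ k)); apply: ler_mean => // [||g Gg].
- exact: (polyfun_actl z (polyfunX k pW)).
- exact: polyfun_cst.
rewrite lerXn2r ?nnegrE ?W0 ?subr_ge0//.
rewrite lerB// leNgt; apply/negP => gd; apply: hg; exists g => //.
Qed.

Lemma compact_idist_min z x0 : exists2 g, inG g &
  forall h, inG h -> idist (act g z) x0 <= idist (act h z) x0.
Proof.
apply: compact_polyfun_min => //; first by exists e; exact: rag_e_in.
exact: (polyfun_actl z (polyfun_idist x0)).
Qed.

(** If the point of the orbit of x nearest to y were not y, its distance to y would be positive, and
    [idist_proper] would produce a nearer one. *)
Lemma quotient_fibre x y : inX x -> inX y -> pmeval F x = pmeval F y ->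
  exists2 g, inG g & act g x = y.
Proof.
move=> Xx Xy Fxy; have [g Gg gmin] := compact_idist_min x y.
exists g => //; apply: contrapT => /eqP gxy; have Xgx := pg_act_in Gg Xx.
have [c c0 hc] := idist_proper Xy (idist_gt0 Xgx Xy gxy).
have [|h Gh] := hc x Xx; first by rewrite Fxy subrr normr0.
by apply/negP; rewrite -leNgt gmin.
Qed.

End InvariantDistance.

(** * The slice through a free point *)

Section Differentials.
Variable R : realType.

Lemma dpevalZ n (p : mpoly n R) x s u : dpeval p x (s *: u) = s * dpeval p x u.
Proof. by rewrite /dpeval mulr_sumr; apply: eq_bigr => i _; rewrite mxE mulrA. Qed.

(** Connects the formal differential with values: polynomials known only through their values, such
    as means, can then be differentiated. *)
Lemma dpeval_uniq n (p : mpoly n R) x v d C :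
  (forall s, 0 < s <= 1 -> `|peval p (x + s *: v) - peval p x - s * d| <= C * s ^+ 2) ->
  dpeval p x v = d.
Proof.
move=> h; have [C' C'0 h'] := taylor2 p (`|x| + `|v|).
set M := `|C| + C' * `|v| ^+ 2.
have M0 : 0 <= M by rewrite addr_ge0 ?mulr_ge0 ?exprn_ge0.
have key s : 0 < s <= 1 -> `|dpeval p x v - d| <= M * s.
  move=> s01; have /andP[s0 s1] := s01.
  have xs : `|x| <= `|x| + `|v| by rewrite lerDl.
  have vs : `|s *: v| <= `|x| + `|v|.
    by rewrite normrZ gtr0_norm// ler_wpDl// ler_piMl.
  have := h' x _ xs vs; rewrite dpevalZ normrZ (gtr0_norm s0) exprMn => h1.
  have h2 := h s s01; rewrite -(ler_pM2l s0) -{1}(gtr0_norm s0) -normrM.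
  rewrite (_ : s * _ = (peval p (x + s *: v) - peval p x - s * d) -
    (peval p (x + s *: v) - peval p x - s * dpeval p x v)); last by ring.
  apply: le_trans (ler_normB _ _) _.
  apply: le_trans (lerD h2 h1) _; rewrite /M.
  have : C * s ^+ 2 <= `|C| * s ^+ 2 by rewrite ler_wpM2r ?exprn_ge0 ?ler_norm// ltW.
  by move=> h3; rewrite (_ : s * _ = `|C| * s ^+ 2 + C' * (s ^+ 2 * `|v| ^+ 2)) ?lerD2r//; ring.
apply/eqP; rewrite -subr_eq0 -normr_le0; apply/ler_addgt0Pl => t t0; rewrite addr0.
have M1 : 0 < M + 1 by rewrite ltr_wpDl.
pose s := Num.min 1 (t / (M + 1)).
have s0 : 0 < s by rewrite lt_min ltr01 divr_gt0.
have sM : s * (M + 1) <= t by rewrite -ler_pdivlMr// ge_min lexx orbT.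
have /key h1 : 0 < s <= 1 by rewrite s0 ge_min lexx.
by apply: (le_trans h1); apply: le_trans sM; rewrite mulrC ler_pM2l// lerDl.
Qed.

Lemma dpevalB n (p q : mpoly n R) x u :
  dpeval (p - q) x u = dpeval p x u - dpeval q x u.
Proof.
rewrite /dpeval -sumrB; apply: eq_bigr => i _.
by rewrite mderivB pevalB mulrBr.
Qed.

Lemma dpeval_sum n k (p : 'I_k -> mpoly n R) x u :
  dpeval (\sum_i p i) x u = \sum_i dpeval (p i) x u.
Proof.
elim/big_rec2: _ => [|i a b _ <-]; last by rewrite dpevalD.
by rewrite -(mpolyC0 n) dpevalC.
Qed.

Lemma peval_sum n k (p : 'I_k -> mpoly n R) x :
  peval (\sum_i p i) x = \sum_i peval (p i) x.
Proof.
elim/big_rec2: _ => [|i a b _ <-]; last by rewrite pevalD.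
by rewrite -(mpolyC0 n) pevalC.
Qed.

Lemma pevalXn n (p : mpoly n R) k x : peval (p ^+ k) x = peval p x ^+ k.
Proof. by elim: k => [|k IH]; rewrite ?expr0 ?(pevalC 1)// !exprS pevalM IH. Qed.

Lemma dpevalXn n (p : mpoly n R) k x u :
  dpeval (p ^+ k.+1) x u = k.+1%:R * (peval p x ^+ k * dpeval p x u).
Proof.
elim: k => [|k IH]; first by rewrite expr1 expr0 !mul1r.
rewrite exprS dpevalM IH pevalXn -[k.+2%:R]natr1 [peval p x ^+ k.+1]exprS; ring.
Qed.

Lemma dpeval_row m n (p : mpoly n R) (P : mpoly (m + n) R) g x v :
  (forall y, peval p y = peval P (row_mx g y)) ->
  dpeval p x v = dpeval P (row_mx g x) (row_mx 0 v).
Proof.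
move=> pP; have [C _ h] := taylor2 P (`|row_mx g x| + `|row_mx (0 : 'rV[R]_m) v|).
apply: (@dpeval_uniq _ _ _ _ _ (C * `|row_mx (0 : 'rV[R]_m) v| ^+ 2)) => s /andP[s0 s1].
have h1 : `|s *: row_mx (0 : 'rV[R]_m) v| <= `|row_mx g x| + `|row_mx (0 : 'rV[R]_m) v|.
  by rewrite normrZ gtr0_norm// ler_wpDl// ler_piMl.
have := h (row_mx g x) _ _ h1; rewrite lerDl normr_ge0 => /(_ isT).
rewrite dpevalZ normrZ (gtr0_norm s0) exprMn (mulrC (s ^+ 2)) mulrA !pP.
by rewrite scale_row_mx scaler0 add_row_mx addr0.
Qed.

(** Lets a factor depending on g alone enter a polynomial in (g, y) as a constant for
    differentiation in y. *)
Lemma polyfun_lift m n (f : 'rV[R]_m -> R) : polyfun f ->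
  exists P : mpoly (m + n) R, (forall g y, peval P (row_mx g y) = f g) /\
    forall g x v, dpeval P (row_mx g x) (row_mx 0 v) = 0.
Proof.
move=> pf; have [P PE] : polyfun (fun w : 'rV[R]_(m + n) => f (lsubmx w)).
  exact: (polyfun_comp pf (@polyfunv_l _ _ _)).
have PE' g y : peval P (row_mx g y) = f g by rewrite -PE row_mxKl.
exists P; split=> // g x v; rewrite -(@dpeval_row _ _ (mpolyC n (f g))) ?dpevalC// => y.
by rewrite pevalC PE'.
Qed.

End Differentials.

Section MeanDifferential.
Variables (R : realType) (m : nat) (G : realAlgGroup R m).
Hypothesis Gcompact : compact (G : set 'rV[R]_m).

Lemma polyfun_dpeval_row n (P : mpoly (m + n) R) x v :
  polyfun (fun g => dpeval P (row_mx g x) (row_mx 0 v)).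
Proof. exact: (polyfun_row (F := fun w => dpeval P w _) _ (polyfun_dpeval _ _)). Qed.

(** Differentiation under the mean: the second-order remainder is bounded uniformly over the bounded
    group, so its mean obeys the same bound. *)
Lemma dpeval_mean n (p : mpoly n R) (P : mpoly (m + n) R) x v :
  (forall y, peval p y = mean G (fun g => peval P (row_mx g y))) ->
  dpeval p x v = mean G (fun g => dpeval P (row_mx g x) (row_mx 0 v)).
Proof.
move=> pP; have [B B0 hB] := rag_bounded Gcompact.
have [C C0 h] := taylor2 P (B + `|x| + `|v|).
have pr y : polyfun (fun g => peval P (row_mx g y)).
  exact: (polyfun_row _ (polyfun_peval P)).
have pd := polyfun_dpeval_row P x v.
have pZ s : polyfun (fun g => s * dpeval P (row_mx g x) (row_mx 0 v)).
  by apply: polyfunM => //; exact: polyfun_cst.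
apply: (@dpeval_uniq _ _ _ _ _ _ (C * `|v| ^+ 2)) => s /andP[s0 s1].
rewrite !pP -meanZ// -!meanB//; last exact: polyfunB.
apply: (mean_norm_le Gcompact) => [|g Gg]; first by do 2?apply: polyfunB.
have dZ : s * dpeval P (row_mx g x) (row_mx 0 v) = dpeval P (row_mx g x) (row_mx 0 (s *: v)).
  by rewrite -dpevalZ scale_row_mx scaler0.
rewrite dZ (_ : row_mx g (x + s *: v) = row_mx g x + row_mx 0 (s *: v)); last first.
  by rewrite add_row_mx addr0.
have n1 : `|row_mx g x| <= B + `|x| + `|v|.
  apply: norm_row_mx; last by rewrite -addrA addrCA lerDl addr_ge0// ltW.
  by rewrite (le_trans (hB _ Gg))// -addrA lerDl addr_ge0.
have nv : `|row_mx (0 : 'rV[R]_m) (s *: v)| <= s * `|v|.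
  by apply: norm_row_mx; rewrite ?normr0 ?normrZ ?gtr0_norm// mulr_ge0// ltW.
have n2 : `|row_mx (0 : 'rV[R]_m) (s *: v)| <= B + `|x| + `|v|.
  apply: (le_trans nv); rewrite ler_wpDl//; first by rewrite addr_ge0// ltW.
  by rewrite ler_piMl.
apply: (le_trans (h _ _ n1 n2)); rewrite -mulrA ler_wpM2l// -exprMn mulrC.
by rewrite lerXn2r ?nnegrE// mulr_ge0// ltW.
Qed.

End MeanDifferential.

Section Slice.
Variables (R : realType) (m : nat) (G : realAlgGroup R m).
Hypothesis Gcompact : compact (G : set 'rV[R]_m).
Variables (n : nat) (X : polyGset G n) (x0 : 'rV[R]_n).
Hypothesis Xx0 : pg_set X x0.
Hypothesis x0free : forall g, rag_set G g -> pg_act X g x0 = x0 -> g = rag_e G.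

Local Notation mul := (rag_mul G).
Local Notation inv := (rag_inv G).
Local Notation e := (rag_e G).
Local Notation inG x := (rag_set G x).
Local Notation mean := (mean G).
Local Notation act := (pg_act X).
Local Notation inX x := (pg_set X x).
Local Notation idist := (idist X).

Definition slice := [set z | inX z /\
  forall g, inG g -> idist z x0 <= idist (act g z) x0].

(* The differential at x0 of the action, g being fixed. *)
Definition dact v g i : R := dpeval (pg_actp X i) (row_mx g x0) (row_mx 0 v).

(** The pairing of v with z - x0 in the averaged scalar product: g acts on v by its differential at
    x0 and on the difference pointwise. *)
Definition slice_coord v z : R :=
  mean (fun g => \sum_i dact v g i * (act g z ord0 i - act g x0 ord0 i)).

Lemma polyfun_dact v i : polyfun (fun g => dact v g i).
Proof. exact: polyfun_dpeval_row. Qed.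

(** The factor act g z - act g x0 vanishes at z = x0, so the product rule leaves only its
    derivative, which is again [dact]. *)
Lemma slice_coordP v : exists2 p, forall z, peval p z = slice_coord v z &
  dpeval p x0 v = mean (fun g => \sum_i dact v g i ^+ 2).
Proof.
have /choice[A hA] i := polyfun_lift n (polyfun_dact v i).
have /choice[C hC] i := polyfun_lift n (polyfunv_actl X x0 i).
pose P := \sum_i A i * (pg_actp X i - C i).
have PE g z : peval P (row_mx g z) =
    \sum_i dact v g i * (act g z ord0 i - act g x0 ord0 i).
  rewrite peval_sum; apply: eq_bigr => i _.
  by rewrite pevalM pevalB (hA i).1 (hC i).1 /pg_act !mxE.
have dPE g : dpeval P (row_mx g x0) (row_mx 0 v) = \sum_i dact v g i ^+ 2.
  rewrite dpeval_sum; apply: eq_bigr => i _.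
  by rewrite dpevalM dpevalB (hA i).1 (hA i).2 (hC i).2 mul0r add0r subr0 expr2.
have [p pE] := polyfun_mean Gcompact (polyfun_peval P).
exists p => [z|]; first by rewrite -pE; congr mean; apply/funext => g.
rewrite (dpeval_mean Gcompact (P := P)); last by move=> y; rewrite -pE.
by congr mean; apply/funext => g.
Qed.

Section ConormalDirection.
Variable v : 'rV[R]_n.
Hypothesis vK : forall p, invariant_on X p -> dpeval p x0 v = 0.

(** A polynomial that vanishes on X is invariant, hence its differential kills v. So v lies in the
    Zariski tangent space of X at x0, and differentials along v depend only on restrictions to X. *)
Lemma dpeval_vanishing p q : (forall x, inX x -> peval p x = peval q x) ->
  dpeval p x0 v = dpeval q x0 v.
Proof.
move=> pq; apply/eqP; rewrite -subr_eq0 -dpevalB; apply/eqP/vK => g x Gg Xx.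
by rewrite !pevalB !pq ?subrr//; exact: pg_act_in.
Qed.

(** At g = e the action polynomials are the identity on X but perhaps not off X; a differential
    along v does not see the difference. *)
Lemma dpeval_at_e (P : mpoly (m + n) R) q :
  (forall x, inX x -> peval P (row_mx e x) = peval q x) ->
  dpeval P (row_mx e x0) (row_mx 0 v) = dpeval q x0 v.
Proof.
move=> Pq; rewrite -(@dpeval_row _ _ _ (ppcomp P (ppair e))) => [|y].
  by apply: dpeval_vanishing => x Xx; rewrite peval_comp pmeval_pair Pq.
by rewrite peval_comp pmeval_pair.
Qed.

Lemma dact_e i : dact v e i = v ord0 i.
Proof.
rewrite /dact (@dpeval_at_e _ (mpolyX R (mnm1 i))) ?dpevalX// => x Xx.
by rewrite pevalX -{2}(pg_act1 Xx) /pg_act mxE.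
Qed.

Lemma mean_dact_gt0 : v != 0 -> 0 < mean (fun g => \sum_i dact v g i ^+ 2).
Proof.
move=> v0; apply: mean_gt0 => // [|g _|].
- by apply: polyfun_sum => i; apply: polyfunX; exact: polyfun_dact.
- by apply: sumr_ge0 => i _; exact: sqr_ge0.
- rewrite (_ : \sum_i _ = nsq v) ?nsq_gt0//.
  by apply: eq_bigr => i _; rewrite dact_e.
Qed.

(* The function E = d(., x0) + d(., z) attains its minimum on the orbit of x0
   at x0 only. Hence the invariants mean_g (rho - E(g x))^k concentrate at x0,
   and v kills the differential of E at x0, which is -2 slice_coord v z on v. *)
Lemma slice_coord0 z : slice z -> slice_coord v z = 0.
Proof.
move=> [Xz zmin]; pose E x := idist x x0 + idist x z.
have pE : polyfun E by apply: polyfunD; exact: polyfun_idist.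
have [B _ hB] := rag_bounded Gcompact.
have [rho _ hrho] := polyfun_bounded B (polyfun_actl X x0 pE).
have [P PE] : polyfun (fun w : 'rV[R]_(m + n) => rho - E (act (lsubmx w) (rsubmx w))).
  apply: polyfunB; first exact: polyfun_cst.
  apply: (polyfun_comp pE).
  by apply: polyfunv_act; [exact: polyfunv_l|exact: polyfunv_r].
have PE' g x : peval P (row_mx g x) = rho - E (act g x).
  by rewrite -PE row_mxKl row_mxKr.
(* The first term of E increases strictly because x0 is free; the second is d(x0, g^-1 z), which is
   at least d(x0, z) because z is a nearest point. *)
have Emin g : inG g -> g <> e -> E (act e x0) < E (act g x0).
  move=> Gg ge; rewrite pg_act1//; have Xg := pg_act_in Gg Xx0.
  have Gg' := rag_inv_in Gg.
  apply: ltr_leD; first by rewrite idistxx// idist_gt0//; apply/eqP => /(x0free Gg).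
  rewrite idistC -(actKV Gg Xz) idist_act//; last exact: pg_act_in.
  by rewrite actKV// (idistC X x0); exact: zmin.
have dP : dpeval P (row_mx e x0) (row_mx 0 v) = 0.
  apply: (mean_concentration Gcompact (w := fun g => peval P (row_mx g x0))
    (f := fun g => dpeval P (row_mx g x0) (row_mx 0 v))).
  - exact: (polyfun_row _ (polyfun_peval P)).
  - exact: polyfun_dpeval_row.
  - move=> g Gg; rewrite PE' subr_ge0; apply: le_trans (ler_norm _) _.
    exact/hrho/hB.
  - by move=> g Gg ge; rewrite !PE' ltrD2l ltrN2 Emin.
  (* The exponent k + 1 is chosen because differentiating the (k + 1)-st power yields the weight
     P^k, as [mean_concentration] wants for every k. *)
  move=> k; have pRE : polyfun (fun x => (rho - E x) ^+ k.+1).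
    by apply: polyfunX; apply: polyfunB => //; exact: polyfun_cst.
  have [p ip p_E] := reynolds Gcompact X pRE.
  have := vK ip; rewrite (dpeval_mean Gcompact (P := P ^+ k.+1)); last first.
    by move=> y; rewrite p_E; congr mean; apply/funext => g; rewrite pevalXn PE'.
  rewrite (_ : (fun g => _) = fun g => k.+1%:R *
      (peval P (row_mx g x0) ^+ k * dpeval P (row_mx g x0) (row_mx 0 v))); last first.
    by apply/funext => g; rewrite dpevalXn.
  rewrite meanZ//; last first.
    apply: polyfunM; last exact: polyfun_dpeval_row.
    by apply: polyfunX; exact: (polyfun_row _ (polyfun_peval P)).
  by move=> /eqP; rewrite mulf_eq0 pnatr_eq0 /= => /eqP.
have [q qE] := pE.
have dq : dpeval q x0 v = 0.
  have : dpeval P (row_mx e x0) (row_mx 0 v) = dpeval (mpolyC n rho - q) x0 v.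
    by apply: dpeval_at_e => x Xx; rewrite PE' pevalB pevalC -qE pg_act1.
  by rewrite dP dpevalB dpevalC sub0r => /esym/eqP; rewrite oppr_eq0 => /eqP.
have /choice[A hA] i := polyfun_lift n (polyfunv_actl X x0 i).
have /choice[C hC] i := polyfun_lift n (polyfunv_actl X z i).
(* The differential of E is computed a second time, directly from the mean that defines E. *)
pose Q := \sum_i ((pg_actp X i - A i) ^+ 2 + (pg_actp X i - C i) ^+ 2).
have QE g y : peval Q (row_mx g y) = nsq (act g y - act g x0) + nsq (act g y - act g z).
  rewrite peval_sum /nsq -big_split; apply: eq_bigr => i _.
  by rewrite pevalD !pevalXn !pevalB (hA i).1 (hC i).1 /pg_act !mxE.
have dQE g : dpeval Q (row_mx g x0) (row_mx 0 v) =
    -2 * \sum_i dact v g i * (act g z ord0 i - act g x0 ord0 i).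
  rewrite dpeval_sum mulr_sumr; apply: eq_bigr => i _.
  rewrite dpevalD !dpevalXn !expr1 !pevalB !dpevalB (hA i).1 (hC i).1 (hA i).2 (hC i).2.
  rewrite -[dpeval (pg_actp X i) _ _]/(dact v g i).
  have -> : peval (pg_actp X i) (row_mx g x0) = act g x0 ord0 i by rewrite /pg_act mxE.
  ring.
move: dq; rewrite (dpeval_mean Gcompact (P := Q)); last first.
  move=> y; rewrite -qE /E /idist -meanD//; try exact: polyfun_nsqactB.
  by congr mean; apply/funext => g; rewrite QE.
rewrite (_ : (fun g => _) = fun g =>
    -2 * \sum_i dact v g i * (act g z ord0 i - act g x0 ord0 i)); last first.
  by apply/funext => g; rewrite dQE.
rewrite meanZ//.
  by move=> /eqP; rewrite mulf_eq0 oppr_eq0 pnatr_eq0 /= => /eqP.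
apply: polyfun_sum => i; apply: polyfunM; first exact: polyfun_dact.
by apply: polyfunB; exact: polyfunv_actl.
Qed.

End ConormalDirection.

Variables (r : nat) (F : polymap R n r).
Hypothesis quotF : geometric_quotient X F.

(** On nearest points such a polynomial has a value determined by the image in the quotient,
    whichever nearest point is chosen; along an arc of the quotient this value is analytic. *)
Definition slice_fun : set (mpoly n R) :=
  [set q | exists p : mpoly r R, forall z, slice z -> peval q z = peval p (pmeval F z)].

Lemma slice_fun_separates v : v != 0 -> exists2 q, slice_fun q & dpeval q x0 v != 0.
Proof.
move=> v0; have [[p ip pv]|h] := pselect (exists2 p, invariant_on X p & dpeval p x0 v != 0).
  exists p => //; have [q pq] := quotF.2 _ ip.
  by exists q => z [Xz _]; exact: pq.
have vK p : invariant_on X p -> dpeval p x0 v = 0.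
  by move=> ip; apply/eqP/negP => /negP pv; apply: h; exists p.
have [q qE dq] := slice_coordP v; exists q; last by rewrite dq gt_eqF// mean_dact_gt0.
(* [slice_coord] vanishes on the slice, so it depends on y as the zero polynomial. *)
by exists 0 => z Sz; rewrite qE slice_coord0// -(mpolyC0 r) pevalC.
Qed.

End Slice.

(** * Convergent power series *)

Section PowerSeries.
Variable R : realType.
Implicit Types (p q : {poly R}) (rho : R).

(** The weighted l1 norm: it is submultiplicative and dominates the supremum over |t| <= rho. A
    series whose truncations are bounded in it converges absolutely there. *)
Definition normp rho p : R := \sum_(i < size p) `|p`_i| * rho ^+ i.

Lemma normp_widen rho p N : (size p <= N)%N -> normp rho p = \sum_(i < N) `|p`_i| * rho ^+ i.
Proof.
move=> pN; rewrite /normp (big_ord_widen _ (fun i => `|p`_i| * rho ^+ i) pN) big_mkcond /=.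
by apply: eq_bigr => i _; case: ltnP => // h; rewrite nth_default ?normr0 ?mul0r.
Qed.

Lemma normp_ge0 rho p : 0 <= rho -> 0 <= normp rho p.
Proof. by move=> r0; apply: sumr_ge0 => i _; rewrite mulr_ge0 ?exprn_ge0. Qed.

Lemma normpD rho p q : 0 <= rho -> normp rho (p + q) <= normp rho p + normp rho q.
Proof.
move=> r0; pose N := maxn (size p) (size q).
rewrite !(@normp_widen _ _ N) ?leq_maxl ?leq_maxr ?size_polyD// -big_split.
apply: ler_sum => i _ /=; rewrite coefD -mulrDl ler_wpM2r ?exprn_ge0//.
exact: ler_normD.
Qed.

Lemma normpN rho p : normp rho (- p) = normp rho p.
Proof. by rewrite /normp size_polyN; apply: eq_bigr => i _; rewrite coefN normrN. Qed.

Lemma normpB rho p q : 0 <= rho -> normp rho (p - q) <= normp rho p + normp rho q.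
Proof. by move=> r0; rewrite -(normpN _ q) normpD. Qed.

Lemma normp0 rho : normp rho 0 = 0.
Proof. by rewrite /normp size_poly0 big_ord0. Qed.

Lemma normpC rho c : normp rho c%:P = `|c|.
Proof.
by rewrite (@normp_widen _ _ 1) ?size_polyC_leq1// big_ord1 coefC expr0 mulr1.
Qed.

Lemma normpMXaddC rho p c : normp rho (p * 'X + c%:P) = `|c| + rho * normp rho p.
Proof.
rewrite (@normp_widen _ _ (size p).+1); last by rewrite size_MXaddC; case: ifP.
rewrite big_ord_recl coefD coefMX coefC /= add0r expr0 mulr1; congr (_ + _).
rewrite mulr_sumr; apply: eq_bigr => i _.
by rewrite coefD coefMX coefC /= addr0 exprS; ring.
Qed.

Lemma normpM rho p q : 0 <= rho -> normp rho (p * q) <= normp rho p * normp rho q.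
Proof.
move=> r0; have Cq c : normp rho (c%:P * q) <= `|c| * normp rho q.
  rewrite (@normp_widen _ _ (size q)); last by rewrite mul_polyC size_scale_leq.
  by rewrite /normp mulr_sumr; apply: ler_sum => i _; rewrite coefCM normrM mulrA.
elim/poly_ind: p => [|p c IH]; first by rewrite mul0r normp0 mul0r.
rewrite normpMXaddC !mulrDl addrC (le_trans (normpD _ _ r0))// lerD//.
rewrite mulrAC -[_ * 'X]addr0 -polyC0 normpMXaddC normr0 add0r -mulrA.
by rewrite ler_wpM2l.
Qed.

Lemma horner_normp rho p t : `|t| <= rho -> `|p.[t]| <= normp rho p.
Proof.
move=> tr; rewrite horner_coef (le_trans (ler_norm_sum _ _ _))//.
apply: ler_sum => i _; rewrite normrM normrX ler_wpM2l// lerXn2r ?nnegrE//.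
exact: le_trans tr.
Qed.

Lemma normp_le_rho rho rho' p : 0 <= rho <= rho' -> normp rho p <= normp rho' p.
Proof.
move=> /andP[r0 rr]; apply: ler_sum => i _; rewrite ler_wpM2l// lerXn2r ?nnegrE//.
exact: le_trans rr.
Qed.

(** The source of smallness: without constant term, shrinking the radius by a factor shrinks the
    norm by the same factor. *)
Lemma normp_shrink rho a p : 0 <= rho -> 0 <= a <= 1 -> p`_0 = 0 ->
  normp (a * rho) p <= a * normp rho p.
Proof.
move=> r0 /andP[a0 a1] p0; rewrite /normp mulr_sumr; apply: ler_sum => -[[|i] lti] _ /=.
  by rewrite p0 normr0 !mul0r mulr0.
rewrite exprMn mulrCA ler_wpM2r ?mulr_ge0 ?exprn_ge0//.
by rewrite exprS ler_piMr// exprn_ile1.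
Qed.

Definition mpz n (p : mpoly n R) (U : 'I_n -> {poly R}) : {poly R} := mmap polyC U p.

Lemma mpzC n c (U : 'I_n -> {poly R}) : mpz (mpolyC n c) U = c%:P.
Proof. exact: mmapC. Qed.

Lemma mpzX n i (U : 'I_n -> {poly R}) : mpz (mpolyX R (mnm1 i)) U = U i.
Proof. by rewrite /mpz mmapX mmap1U. Qed.

Lemma mpzD n (p q : mpoly n R) U : mpz (p + q) U = mpz p U + mpz q U.
Proof. exact: mmapD. Qed.

Lemma mpzM n (p q : mpoly n R) U : mpz (p * q) U = mpz p U * mpz q U.
Proof. exact: (rmorphM (mmap polyC U)). Qed.

Lemma horner_mpz n (p : mpoly n R) U t :
  (mpz p U).[t] = peval p (\row_i (U i).[t]).
Proof.
elim/mpoly_ring_ind: p => [c|i|p q IHp IHq|p q IHp IHq].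
- by rewrite mpzC hornerC pevalC.
- by rewrite mpzX pevalX mxE.
- by rewrite mpzD hornerD IHp IHq pevalD.
- by rewrite mpzM hornerM IHp IHq pevalM.
Qed.

Lemma normp_mpz n (p : mpoly n R) B : exists2 C : R, 0 <= C & forall rho U, 0 <= rho ->
  (forall i, normp rho (U i) <= B) -> normp rho (mpz p U) <= C.
Proof.
elim/mpoly_ring_ind: p => [c|i|p q [C C0 hC] [D D0 hD]|p q [C C0 hC] [D D0 hD]].
- by exists `|c| => // rho U _ _; rewrite mpzC normpC.
- by exists `|B| => // rho U r0 h; rewrite mpzX (le_trans (h i))// ler_norm.
- exists (C + D) => [|rho U r0 h]; first exact: addr_ge0.
  by rewrite mpzD (le_trans (normpD _ _ r0))// lerD ?hC ?hD.
- exists (C * D) => [|rho U r0 h]; first exact: mulr_ge0.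
  by rewrite mpzM (le_trans (normpM _ _ r0))// ler_pM ?normp_ge0 ?hC ?hD.
Qed.

Lemma mpz_congr n (p : mpoly n R) (d : {poly R}) U V :
  (forall i, dvdp d (U i - V i)) -> dvdp d (mpz p U - mpz p V).
Proof.
move=> h; elim/mpoly_ring_ind: p => [c|i|p q IHp IHq|p q IHp IHq].
- by rewrite !mpzC subrr dvdp0.
- by rewrite !mpzX.
- by rewrite !mpzD opprD addrACA dvdp_add.
- rewrite !mpzM (_ : _ - _ = (mpz p U - mpz p V) * mpz q U +
    mpz p V * (mpz q U - mpz q V)); last by ring.
  by apply: dvdp_add; [exact: dvdp_mulr|exact: dvdp_mull].
Qed.

Lemma dvdXn_coef N p j : dvdp 'X^N p -> (j < N)%N -> p`_j = 0.
Proof. by move=> /dvdpP[w ->] jN; rewrite coefMXn jN. Qed.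

Lemma near_dist (t0 e : R) : 0 < e -> \forall t \near t0, `|t - t0| < e.
Proof.
by move=> e0; apply/nbhs_ballP; exists e => //= t; rewrite /ball /= distrC.
Qed.

(* The coefficient of degree j of W N is the same for all N > j: it is the
   coefficient of the power series. *)
Lemma analytic_polys u t0 rho B (W : nat -> {poly R}) : 0 < rho ->
  (forall N, dvdp 'X^N (W N.+1 - W N)) -> (forall N, normp rho (W N) <= B) ->
  (forall t, `|t - t0| < rho -> (W N).[t - t0] @[N --> \oo] --> u t) ->
  analytic_at u t0.
Proof.
move=> r0 dW nW cW; pose c j := (W j.+1)`_j; exists c.
have Wc N j : (j < N)%N -> (W N)`_j = c j.
  elim: N => // N IH; rewrite ltnS leq_eqVlt => /predU1P[->//|jN].
  rewrite -(IH jN); apply/eqP; rewrite -subr_eq0 -coefB; apply/eqP.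
  exact: dvdXn_coef jN.
near=> t; set s := t - t0.
have str : `|t - t0| < rho.
  by near: t; exact: near_dist.
(* Both polynomials have the same coefficients below degree N. Each remaining term, compared with
   its weight in [normp], gains at least (|s| / rho)^N. *)
have diff N : `|(W N).[s] - pseries c s N| <= B * (`|s| / rho) ^+ N.
  have B0 : 0 <= B by apply: le_trans (nW 0%N); apply: normp_ge0; exact: ltW.
  have sr0 : 0 <= `|s| / rho by rewrite divr_ge0// ltW.
  pose M := (N + size (W N))%N.
  rewrite (@horner_coef_wide _ M) ?leq_addl//.
  rewrite /pseries /series /= big_mkord big_split_ord /=.
  rewrite (eq_bigr (fun i : 'I_N => c i * s ^+ i)); last first.
    by move=> i _; rewrite Wc.
  rewrite [_ + _ - _]addrAC subrr add0r (le_trans (ler_norm_sum _ _ _))//.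
  have h : \sum_(i < size (W N)) `|(W N)`_(N + i)| * rho ^+ (N + i) <= B.
    apply: le_trans (nW N); rewrite (@normp_widen _ _ M) ?leq_addl//.
    rewrite [leRHS]big_split_ord /= lerDr; apply: sumr_ge0 => i _.
    by rewrite mulr_ge0// exprn_ge0// ltW.
  apply: le_trans (ler_wpM2r (exprn_ge0 N sr0) h).
  rewrite mulr_suml; apply: ler_sum => i _; rewrite normrM normrX -mulrA ler_wpM2l//.
  have -> : rho ^+ (N + i) * (`|s| / rho) ^+ N = `|s| ^+ N * rho ^+ i.
    have rN : rho ^+ N != 0 by rewrite expf_neq0// gt_eqF.
    by rewrite exprD expr_div_n mulrAC [rho ^+ N * _]mulrC divfK.
  by rewrite exprD ler_wpM2l ?exprn_ge0// lerXn2r ?nnegrE// ltW.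
have sr1 : `| `|s| / rho| < 1.
  by rewrite (ger0_norm (divr_ge0 (normr_ge0 s) (ltW r0))) ltr_pdivrMr// mul1r.
have d0 : (fun N => (W N).[s] - pseries c s N) @ \oo --> 0.
  apply/cvgr0Pnorm_le => e e0; have hB : B * (`|s| / rho) ^+ N @[N --> \oo] --> 0.
    by rewrite -[X in _ --> X](mulr0 B); exact: (cvgM (cvg_cst B) (cvg_expr sr1)).
  move/cvgr0Pnorm_lt : hB => /(_ e e0); apply: filterS => N hN.
  by apply: le_trans (diff N) _; apply: le_trans (ler_norm _) (ltW hN).
rewrite (_ : pseries c s = (fun N => (W N).[s]) \- (fun N => (W N).[s] - pseries c s N)).
  by rewrite -[u t]subr0; exact: (cvgB (cW t str) d0).
by apply/funext => N; rewrite /= opprB addrC subrK.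
Unshelve. all: by end_near. Qed.

End PowerSeries.

(** * Analytic functions of one variable and their truncations *)

Section AnalyticFunctions.
Variable R : realType.
Implicit Types (c : nat -> R) (u : R -> R).

Definition truncp c N : {poly R} := \poly_(j < N) c j.

Lemma horner_truncp c N t : (truncp c N).[t] = pseries c t N.
Proof. by rewrite /truncp horner_poly /pseries /series /= big_mkord. Qed.

Lemma truncpS c N : truncp c N.+1 - truncp c N = (c N)%:P * 'X^N.
Proof.
apply/polyP => j; rewrite coefB coef_poly coef_poly coefCM coefXn ltnS.
case: (ltngtP j N) => [jN|jN|->]; rewrite ?mulr0 ?subrr ?subr0 ?mulr1//.
Qed.

Lemma normp_truncp c rho N : normp rho (truncp c N) = \sum_(j < N) `|c j| * rho ^+ j.
Proof.
rewrite (@normp_widen _ _ _ N) ?size_poly//; apply: eq_bigr => j _.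
by rewrite coef_poly ltn_ord.
Qed.

Lemma analytic_coef u t0 : analytic_at u t0 -> exists c rho B,
  [/\ 0 < rho, forall N, normp rho (truncp c N) <= B,
      forall t, `|t - t0| < rho -> (truncp c N).[t - t0] @[N --> \oo] --> u t
    & c 0%N = u t0].
Proof.
move=> [c /nbhs_ballP[e /= e0 he]]; exists c.
have cv t : `|t - t0| < e -> (truncp c N).[t - t0] @[N --> \oo] --> u t.
  move=> te; rewrite (_ : (fun N => _) = pseries c (t - t0)); last first.
    by apply/funext => N; rewrite horner_truncp.
  by apply: he; rewrite /ball /= distrC.
have e2 : `|t0 + e / 2 - t0| < e by rewrite addrC addKr gtr0_norm; lra.
have [M hM] : exists M, forall j, `|c j| * (e / 2) ^+ j <= M.
  have /cvg_series_bounded : cvgn (pseries c (e / 2)).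
    apply/cvg_ex; exists (u (t0 + e / 2)); have := he (t0 + e / 2).
    rewrite /ball /= distrC => /(_ e2); by rewrite addrC addKr.
  move=> [M [Mr h]]; exists (M + 1) => j.
  have := h (M + 1) _ j I; rewrite ltrDl ltr01 => /(_ isT) /=.
  by rewrite normrM normrX (@gtr0_norm _ (e / 2))// divr_gt0.
have M0 : 0 <= M by apply: le_trans (hM 0%N); rewrite mulr1.
(* The terms of the series are bounded by M at e / 2, hence by M / 2^j at e / 4, and the geometric
   series sums to 2 M. *)
exists (e / 4), (2 * M); split.
- by rewrite divr_gt0.
- move=> N; rewrite normp_truncp.
  suff : \sum_(j < N) `|c j| * (e / 4) ^+ j <= M * (2 - 2 * 2^-1 ^+ N).
    move=> /le_trans; apply; rewrite mulrC ler_wpM2r// lerBlDr lerDl.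
    by rewrite mulr_ge0// exprn_ge0// invr_ge0.
  elim: N => [|N IH]; first by rewrite big_ord0 expr0 mulr1 subrr mulr0.
  rewrite big_ord_recr /=; apply: (le_trans (lerD IH (_ : _ <= M * 2^-1 ^+ N))).
    rewrite (_ : e / 4 = e / 2 * 2^-1); last by field.
    by rewrite exprMn mulrA ler_wpM2r// exprn_ge0// invr_ge0.
  by rewrite -mulrDr ler_wpM2l// exprSr; lra.
- by move=> t te; apply: cv; apply: (lt_le_trans te); lra.
- have h0 : (truncp c N).[t0 - t0] @[N --> \oo] --> u t0 by apply: cv; rewrite subrr normr0.
  apply: (cvg_unique _ _ h0) => //; apply: cvg_near_cst.
  near=> N; rewrite subrr horner_truncp /pseries /series /=.
  have -> : N = N.-1.+1 by rewrite prednK//; near: N; exact: nbhs_infty_gt.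
  rewrite big_nat_recl// expr0 mulr1 big1 ?addr0// => j _.
  by rewrite expr0n mulr0.
Unshelve. all: by end_near. Qed.

(** Without their constant term, the truncations have norm O(|t - t0|) at radius |t - t0|, uniformly
    in N, so the bound passes to the limit. *)
Lemma analytic_continuous u t0 : analytic_at u t0 -> u t @[t --> t0] --> u t0.
Proof.
move=> /analytic_coef[c [rho [B [r0 nB cv c0]]]].
have B0 : 0 <= B by apply: le_trans (nB 0%N); apply: normp_ge0; exact: ltW.
have K0 : 0 < B + `|c 0%N| + 1 by rewrite ltr_wpDl// addr_ge0.
apply/cvgrPdist_le => d d0; near=> t; rewrite distrC.
have tr : `|t - t0| < rho by near: t; exact: near_dist.
have h : (fun N => (truncp c N).[t - t0] - c 0%N) @ \oo --> u t - u t0.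
  by rewrite -c0; apply: cvgB; [exact: cv|exact: cvg_cst].
have bound N : (0 < N)%N -> `|(truncp c N).[t - t0] - c 0%N| <= d.
  move=> N0; set p := truncp c N - (c 0%N)%:P.
  have p0 : p`_0 = 0 by rewrite coefB coef_poly N0 coefC subrr.
  have <- : p.[t - t0] = (truncp c N).[t - t0] - c 0%N by rewrite hornerD hornerN hornerC.
  have a01 : 0 <= `|t - t0| / rho <= 1.
    by rewrite (divr_ge0 (normr_ge0 _) (ltW r0)) ler_pdivrMr// mul1r ltW.
  have sE : `|t - t0| = `|t - t0| / rho * rho by rewrite divfK// gt_eqF.
  apply: (le_trans (@horner_normp _ `|t - t0| p _ (lexx _))); rewrite sE.
  apply: (le_trans (normp_shrink (ltW r0) a01 p0)).
  have pB : normp rho p <= B + `|c 0%N| + 1.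
    apply: (le_trans (normpB _ _ (ltW r0))); by rewrite normpC -addrA lerD ?nB// lerDl.
  apply: (le_trans (ler_wpM2l _ pB)); first by case/andP: a01.
  rewrite mulrAC ler_pdivrMr// -ler_pdivlMr; last exact: K0.
  by apply: ltW; near: t; apply: near_dist; rewrite divr_gt0 ?mulr_gt0.
apply: (cvgr_to_le (cvg_norm h)); near=> N; apply: bound.
by near: N; exact: nbhs_infty_gt.
Unshelve. all: by end_near. Qed.

Lemma cvg_mpz n (p : mpoly n R) (U : nat -> 'I_n -> {poly R}) s (v : 'rV[R]_n) :
  (forall i, (U N i).[s] @[N --> \oo] --> v ord0 i) ->
  (mpz p (U N)).[s] @[N --> \oo] --> peval p v.
Proof.
move=> Uv; elim/mpoly_ring_ind: p => [a|i|p q IHp IHq|p q IHp IHq].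
- rewrite pevalC (_ : (fun N => _) = fun=> a); first exact: cvg_cst.
  by apply/funext => N; rewrite mpzC hornerC.
- rewrite pevalX (_ : (fun N => _) = fun N => (U N i).[s]); first exact: Uv.
  by apply/funext => N; rewrite mpzX.
- rewrite pevalD; set f := fun N => _.
  rewrite (_ : f = (fun N => (mpz p (U N)).[s] + (mpz q (U N)).[s])).
    exact: cvgD.
  by apply/funext => N; rewrite /f mpzD hornerD.
- rewrite pevalM; set f := fun N => _.
  rewrite (_ : f = (fun N => (mpz p (U N)).[s] * (mpz q (U N)).[s])).
    exact: cvgM.
  by apply/funext => N; rewrite /f mpzM hornerM.
Qed.

Lemma common_radius n (f : 'I_n -> R) : (forall i, 0 < f i) ->
  exists2 r : R, 0 < r & forall i, r <= f i.
Proof.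
move=> f0; exists (\big[Num.min/1]_i f i) => [|i].
  by apply/bigmin_gtP; split=> [|i _]; rewrite ?ltr01 ?f0.
exact: bigmin_le_cond.
Qed.

(** Substituting truncations into p gives polynomials that agree modulo X^N and are bounded in norm,
    which is the input of [analytic_polys]. *)
Lemma analytic_peval n (p : mpoly n R) (u : R -> 'rV[R]_n) t0 :
  (forall i, analytic_at (fun t => u t ord0 i) t0) ->
  analytic_at (fun t => peval p (u t)) t0.
Proof.
move=> au.
have /choice[c hc] i := analytic_coef (au i).
have /choice[rho hrho] := hc; have /choice[B hB] := hrho => {hc hrho}.
have [r r0 hr] : exists2 r : R, 0 < r & forall i, r <= rho i.
  by apply: common_radius => i; case: (hB i).
have nW N i : normp r (truncp (c i) N) <= \sum_j `|B j|.
  apply: le_trans (_ : `|B i| <= _).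
    case: (hB i) => _ /(_ N) h _ _; apply: le_trans (ler_norm _).
    by apply: le_trans h; apply: normp_le_rho; rewrite hr andbT ltW.
  by rewrite (bigD1 i)//= lerDl sumr_ge0.
have [C C0 hC] := normp_mpz p (\sum_j `|B j|).
apply: (@analytic_polys _ _ _ r C (fun N => mpz p (fun i => truncp (c i) N))) => // [N|N|t tr].
- by apply: mpz_congr => i; rewrite truncpS dvdp_mull.
- by apply: hC => //; exact: ltW.
- by apply: cvg_mpz => i; case: (hB i) => _ _ cv _; apply: cv; exact: lt_le_trans (hr i).
Qed.

Lemma eq_near_analytic u v t : (\forall s \near t, u s = v s) ->
  analytic_at u t -> analytic_at v t.
Proof.
move=> uv [c hc]; exists c; near=> s; rewrite -(near uv s)//; near: s.
Unshelve. all: by end_near. Qed.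

Lemma near_abs_sub (t0 t1 e : R) : `|t1 - t0| < e -> \forall t \near t1, `|t - t0| < e.
Proof.
move=> te; have e0 : 0 < e - `|t1 - t0| by rewrite subr_gt0.
apply: filterS (near_dist t1 e0) => t h.
rewrite -(subrK t1 t) -addrA (le_lt_trans (ler_normD _ _))//; lra.
Qed.

Lemma analytic_affine u a b s : analytic_at u (a + b * s) ->
  analytic_at (fun t => u (a + b * t)) s.
Proof.
move=> [c /nbhs_ballP[e /= e0 h]]; exists (fun n => c n * b ^+ n).
have b1 : 0 < `|b| + 1 by rewrite ltr_wpDl.
near=> t; have ts : `|t - s| < e / (`|b| + 1) by near: t; apply: near_dist; rewrite divr_gt0.
have := h (a + b * t); rewrite /ball /= opprD addrACA subrr add0r -mulrBr normrM distrC.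
have -> : pseries c (a + b * t - (a + b * s)) = pseries (fun n => c n * b ^+ n) (t - s).
  rewrite opprD addrACA subrr add0r -mulrBr; apply/funext => N.
  by rewrite /pseries /series /=; apply: eq_bigr => i _; rewrite exprMn mulrA.
apply; apply: le_lt_trans (_ : (`|b| + 1) * `|t - s| < e).
  by rewrite ler_wpM2r// lerDl.
by rewrite mulrC -ltr_pdivlMr.
Unshelve. all: by end_near. Qed.

End AnalyticFunctions.

(** * The analytic inverse function theorem along arcs *)

Section AnalyticInverse.
Variable R : realType.

Lemma polyfun_shift n (f : 'rV[R]_n -> R) x0 : polyfun f -> polyfun (fun u => f (x0 + u)).
Proof.
move=> pf; apply: (polyfun_comp pf).
by apply: polyfunvD; [exact: polyfunv_cst|exact: polyfunv_id].
Qed.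

Lemma polyfun_dpevalr n (p : mpoly n R) x : polyfun (dpeval p x).
Proof. by apply: polyfun_sum => i; apply: polyfunM; [exact: polyfun_coord|exact: polyfun_cst]. Qed.

Lemma taylor_remainder n (p : mpoly n R) x0 : exists S : 'I_n -> 'I_n -> mpoly n R,
  forall u, peval p (x0 + u) = peval p x0 + dpeval p x0 u +
    \sum_k \sum_l u ord0 k * u ord0 l * peval (S k l) u.
Proof.
have sum0 (u : 'rV[R]_n) :
    \sum_(k < n) \sum_(l < n) u ord0 k * u ord0 l * peval (mpolyC n (0 : R)) u = 0.
  by rewrite big1// => k _; rewrite big1// => l _; rewrite pevalC mulr0.
elim/mpoly_ring_ind: p => [c|i|p q [S hS] [T hT]|p q [S hS] [T hT]].
- by exists (fun _ _ => mpolyC n 0) => u; rewrite sum0 !pevalC dpevalC !addr0.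
- by exists (fun _ _ => mpolyC n 0) => u; rewrite sum0 !pevalX dpevalX mxE addr0.
- exists (fun k l => S k l + T k l) => u; rewrite !pevalD dpevalD hS hT.
  rewrite [X in _ = _ + X](_ : _ = \sum_k \sum_l u ord0 k * u ord0 l * peval (S k l) u +
    \sum_k \sum_l u ord0 k * u ord0 l * peval (T k l) u); first by ring.
  rewrite -big_split; apply: eq_bigr => k _; rewrite -big_split; apply: eq_bigr => l _.
  by rewrite pevalD mulrDr.
have [q' q'E] := polyfun_shift x0 (polyfun_peval q).
have [L LE] := polyfunD (polyfun_cst n (peval p x0)) (polyfun_dpevalr p x0).
(* Only one factor is expanded fully: p q = (p(x0) + dp) q + R_p q with R_p the remainder of p, and
   q is expanded in the first term. The three summands come from dp dq, R_p q and (p(x0) + dp)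
   R_q. *)
exists (fun k l => mpolyC n (peval (mderiv k p) x0) * mpolyC n (peval (mderiv l q) x0) +
  S k l * q' + L * T k l) => u.
rewrite [X in _ = _ + X](_ : _ = dpeval p x0 u * dpeval q x0 u +
    (\sum_k \sum_l u ord0 k * u ord0 l * peval (S k l) u) * peval q (x0 + u) +
    (peval p x0 + dpeval p x0 u) * (\sum_k \sum_l u ord0 k * u ord0 l * peval (T k l) u)).
  by rewrite !pevalM dpevalM hS hT; ring.
rewrite [dpeval p x0 u * _]big_distrlr mulr_suml mulr_sumr -!big_split.
apply: eq_bigr => k _; rewrite mulr_suml mulr_sumr -!big_split.
by apply: eq_bigr => l _; rewrite !pevalD !pevalM !pevalC -q'E -LE /=; ring.
Qed.

(** What the iteration u = b - Q(u) needs from a Q vanishing to second order at 0: one more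
    coefficient is settled at each step, iterates stay in a small ball, and the map contracts
    there. *)
Record order2 n (Q : mpoly n R) : Prop := Order2 {
  order2_dvd : forall N (U V : 'I_n -> {poly R}),
    (forall i, dvdp 'X (U i)) -> (forall i, dvdp 'X (V i)) ->
    (forall i, dvdp 'X^N (U i - V i)) -> dvdp 'X^(N.+1) (mpz Q U - mpz Q V);
  order2_normp : exists2 K : R, 0 <= K & forall (rho d : R) (U : 'I_n -> {poly R}),
    0 <= rho -> 0 <= d <= 1 ->
    (forall i, normp rho (U i) <= d) -> normp rho (mpz Q U) <= K * d ^+ 2;
  order2_lip : exists2 K : R, 0 <= K & forall (d : R) (u v : 'rV[R]_n), d <= 1 ->
    `|u| <= d -> `|v| <= d -> `|peval Q u - peval Q v| <= K * d * `|u - v| }.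

Lemma order2_0 n : order2 (0 : mpoly n R).
Proof.
rewrite -(mpolyC0 n); split=> [N U V _ _ _||].
- by rewrite !mpzC subrr dvdp0.
- by exists 0 => // rho d U _ _ _; rewrite mpzC normpC normr0 mul0r.
- by exists 0 => // d u v _ _ _; rewrite !pevalC subrr normr0 !mul0r.
Qed.

Lemma order2D n (p q : mpoly n R) : order2 p -> order2 q -> order2 (p + q).
Proof.
move=> [dp [K K0 np] [L L0 lp]] [dq [K' K'0 nq] [L' L'0 lq]]; split=> [N U V hU hV hUV||].
- by rewrite !mpzD opprD addrACA dvdp_add ?dp ?dq.
- exists (K + K') => [|rho d U r0 d1 hU]; first exact: addr_ge0.
  by rewrite mpzD (le_trans (normpD _ _ r0))// mulrDl lerD ?np ?nq.
- exists (L + L') => [|d u v d1 ud vd]; first exact: addr_ge0.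
  by rewrite !pevalD opprD addrACA (le_trans (ler_normD _ _))// !mulrDl lerD ?lp ?lq.
Qed.

Lemma order2_XXM n (S : mpoly n R) k l :
  order2 (mpolyX R (mnm1 k) * mpolyX R (mnm1 l) * S).
Proof.
split=> [N U V hU hV hUV||].
- rewrite !mpzM !mpzX (_ : _ - _ = (U k - V k) * U l * mpz S U +
    V k * (U l - V l) * mpz S U + V k * V l * (mpz S U - mpz S V)); last by ring.
  rewrite exprSr !dvdp_add//.
  + by rewrite dvdp_mulr// dvdp_mul.
  + by rewrite dvdp_mulr// mulrC dvdp_mul.
  + rewrite [X in dvdp _ X](_ : _ = V k * (V l * (mpz S U - mpz S V))); last by ring.
    by apply: dvdp_mull; rewrite mulrC; apply: dvdp_mul => //; exact: mpz_congr.
- have [C C0 hC] := normp_mpz S 1; exists C => // rho d U r0 /andP[d0 d1] hU.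
  rewrite !mpzM !mpzX (le_trans (normpM _ _ r0))// mulrC ler_pM ?normp_ge0//.
    by apply: hC => // i; exact: le_trans d1.
  by rewrite (le_trans (normpM _ _ r0))// expr2 ler_pM ?normp_ge0.
- have [C C0 hC] := polyfun_bounded 1 (polyfun_peval S).
  have [L /ltW L0 hL] := polyfun_lipschitz 1 (polyfun_peval S).
  exists (C + C + L) => [|d u v d1 ud vd]; first by rewrite !addr_ge0.
  have d0 : 0 <= d := le_trans (normr_ge0 _) ud.
  have u1 := le_trans ud d1; have v1 := le_trans vd d1.
  have uk j := le_trans (norm_coord u j) ud; have vk j := le_trans (norm_coord v j) vd.
  have uvk j : `|u ord0 j - v ord0 j| <= `|u - v|.
    by have := norm_coord (u - v) j; rewrite !mxE.
  rewrite !pevalM !pevalX.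
  rewrite (_ : _ - _ = (u ord0 k - v ord0 k) * u ord0 l * peval S u +
    v ord0 k * (u ord0 l - v ord0 l) * peval S u +
    v ord0 k * v ord0 l * (peval S u - peval S v)); last by ring.
  rewrite (le_trans (ler_normD _ _))// (le_trans (lerD (ler_normD _ _) (lexx _)))//.
  rewrite !normrM !mulrDl; apply: lerD; first apply: lerD.
  + rewrite (_ : C * d * _ = `|u - v| * d * C); last by ring.
    by rewrite !ler_pM ?mulr_ge0 ?hC.
  + rewrite (_ : C * d * _ = d * `|u - v| * C); last by ring.
    by rewrite !ler_pM ?mulr_ge0 ?hC.
  + rewrite (_ : L * d * _ = d * 1 * (L * `|u - v|)); last by ring.
    by rewrite !ler_pM ?mulr_ge0 ?hL// (le_trans (vk _)).
Qed.

Lemma taylor_order2 n (p : mpoly n R) x0 : exists2 Q, order2 Q &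
  forall u, peval p (x0 + u) = peval p x0 + dpeval p x0 u + peval Q u.
Proof.
have [S hS] := taylor_remainder p x0.
exists (\sum_k \sum_l mpolyX R (mnm1 k) * mpolyX R (mnm1 l) * S k l) => [|u].
  have sum2 I (s : seq I) (f : I -> mpoly n R) :
      (forall i, order2 (f i)) -> order2 (\sum_(i <- s) f i).
    move=> h; elim/big_ind: _ => [|p1 p2|i _]; [exact: order2_0|exact: order2D|exact: h].
  by apply: (sum2 _) => k; apply: (sum2 _) => l; exact: order2_XXM.
rewrite hS peval_sum; congr (_ + _); apply: eq_bigr => k _; rewrite peval_sum.
by apply: eq_bigr => l _; rewrite !pevalM !pevalX.
Qed.

Lemma half_contraction (a b : nat -> R) : (forall N, 0 <= a N) ->
  (forall N, a N.+1 <= b N + a N / 2) -> b @ \oo --> 0 -> a @ \oo --> 0.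
Proof.
move=> a0 ab /cvgr0Pnorm_lt b0; apply/cvgr0Pnorm_lt => d d0.
have d4 : 0 < d / 4 by rewrite divr_gt0.
have [M _ hM] := b0 _ d4.
have key N : a (M + N)%N <= d / 2 + a M * 2^-1 ^+ N.
  elim: N => [|N IH]; first by rewrite addn0 expr0 mulr1 lerDr divr_ge0// ltW.
  rewrite addnS (le_trans (ab _))//; have := hM (M + N)%N (leq_addr _ _).
  move=> /(le_lt_trans (ler_norm _)); rewrite exprSr mulrA; lra.
have h : a M * 2^-1 ^+ N @[N --> \oo] --> 0.
  rewrite -[X in _ --> X](mulr0 (a M)); apply: (cvgM (cvg_cst _) (cvg_expr _)).
  by rewrite ger0_norm ?invr_ge0//; lra.
have d2 : 0 < d / 2 by rewrite divr_gt0.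
move/cvgr0Pnorm_lt : h => /(_ _ d2)[M' _ hM'].
exists (M + M')%N => // N /= MN; have := hM' (N - M)%N.
have MN1 : (M <= N)%N by rewrite (leq_trans _ MN)// leq_addr.
rewrite /= leq_subRL// => /(_ MN) /(le_lt_trans (ler_norm _)).
have := key (N - M)%N; rewrite subnKC// ger0_norm//; lra.
Qed.

(** Since the differential is the identity, u = z - z(t1) solves u = b - Q(u), where b is the
    analytic increment of P(z). The iteration is run on polynomials in t - t1; continuity of z keeps
    u in the ball where Q contracts, so the iterates converge to u itself and not to another
    solution. *)
Lemma analytic_inverse_id n (P : 'I_n -> mpoly n R) (z : R -> 'rV[R]_n) t1 :
  (forall i, analytic_at (fun t => peval (P i) (z t)) t1) ->
  z t @[t --> t1] --> z t1 ->
  (forall i u, dpeval (P i) (z t1) u = u ord0 i) ->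
  forall i, analytic_at (fun t => z t ord0 i) t1.
Proof.
move=> aP cz dP; set x1 := z t1 in cz dP *.
have /choice[Q hQ] : forall i, exists Q, order2 Q /\
    forall u, peval (P i) (x1 + u) = peval (P i) x1 + u ord0 i + peval Q u.
  by move=> i; have [Q oQ QE] := taylor_order2 (P i) x1; exists Q; split=> // u; rewrite QE dP.
have /choice[c hc] i := analytic_coef (aP i).
have /choice[rho0 hrho] := hc; have /choice[B hB] := hrho => {hc hrho}.
have [r r0 hr] : exists2 r : R, 0 < r & forall i, r <= rho0 i.
  by apply: common_radius => i; case: (hB i).
have /choice[K hK] : forall i, exists K : R, 0 <= K /\
    forall (rho d : R) (U : 'I_n -> {poly R}), 0 <= rho -> 0 <= d <= 1 ->
    (forall i, normp rho (U i) <= d) -> normp rho (mpz (Q i) U) <= K * d ^+ 2.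
  by move=> i; have [K K0 h] := order2_normp (hQ i).1; exists K.
have /choice[L hL] : forall i, exists K : R, 0 <= K /\
    forall (d : R) (u v : 'rV[R]_n), d <= 1 ->
    `|u| <= d -> `|v| <= d -> `|peval (Q i) u - peval (Q i) v| <= K * d * `|u - v|.
  by move=> i; have [K' K'0 h] := order2_lip (hQ i).1; exists K'.
pose KL := \sum_i (K i + L i).
have KL0 i : K i <= KL /\ L i <= KL.
  have h j : 0 <= K j + L j by rewrite addr_ge0 ?(hK j).1 ?(hL j).1.
  have : K i + L i <= KL by rewrite /KL (bigD1 i)//= lerDl sumr_ge0.
  by have := (hK i).1; have := (hL i).1; split; lra.
have KLge0 : 0 <= KL by apply: sumr_ge0 => j _; rewrite addr_ge0 ?(hK j).1 ?(hL j).1.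
(* Radius on which Q is Lipschitz with constant 1/2 and maps the d-ball into the d/2-ball; the data
   b fill the other d/2. *)
pose d : R := (2 * (KL + 1))^-1.
have K1 : 0 < 2 * (KL + 1) by lra.
have d0 : 0 < d by rewrite invr_gt0.
have dK : KL * d <= 2^-1.
  by rewrite /d invfM mulrCA ler_piMr ?invr_ge0// ler_pdivrMr ?mul1r; lra.
have d1 : d <= 1 by rewrite /d invf_le1//; lra.
(* The truncation keeps the degrees up to N, so that b changes at step N only by a multiple of X^(N
   + 1), in pace with the gain of [order2_dvd]. Removing the constant term makes [normp_shrink]
   applicable. *)
pose b i N := truncp (c i) N.+1 - (c i 0%N)%:P.
have b0 i N : (b i N)`_0 = 0 by rewrite coefB coef_poly coefC subrr.
pose M := \sum_i (`|B i| + `|c i 0%N|) + 1.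
have Mi i : `|B i| + `|c i 0%N| <= M.
  by rewrite /M (bigD1 i)//= -addrA lerDl addr_ge0// sumr_ge0// => j _; rewrite addr_ge0.
have M0 : 0 < M by rewrite ltr_wpDl// sumr_ge0// => j _; rewrite addr_ge0.
have nb i N : normp r (b i N) <= M.
  apply: le_trans (Mi i); apply: (le_trans (normpB _ _ (ltW r0))); rewrite normpC lerD2r.
  apply: le_trans (ler_norm _); case: (hB i) => _ /(_ N.+1) h _ _.
  by apply: le_trans h; apply: normp_le_rho; rewrite hr andbT ltW.
have [d' d'0 hd'] : exists2 d' : R, 0 < d' & forall t, `|t - t1| < d' -> `|z t - x1| <= d.
  move/cvgrPdist_le : cz => /(_ d d0) /nbhs_ballP[d' /= d'0 h]; exists d' => // t td.
  by rewrite distrC; apply: h; rewrite /ball /= distrC.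
(* The shrinking factor of the radius: d / 2 / M makes b small, d' / r keeps z within d of z(t1),
   and 1 keeps the radius below r. *)
pose a : R := Num.min 1 (Num.min (d / 2 / M) (d' / r)).
have a0 : 0 < a by rewrite !lt_min ltr01 !divr_gt0.
have a1 : a <= 1 by rewrite ge_min lexx.
have aM : a * M <= d / 2 by rewrite -ler_pdivlMr// !ge_min lexx orbT.
have ar : a * r <= d' by rewrite -ler_pdivlMr// !ge_min lexx !orbT.
pose rho := a * r; have rho_gt0 : 0 < rho by rewrite mulr_gt0.
have rho_r : rho <= r by rewrite ler_piMl// ltW.
have nb' i N : normp rho (b i N) <= d / 2.
  apply: (le_trans (normp_shrink (ltW r0) _ (b0 i N))); first by rewrite (ltW a0).
  by apply: le_trans aM; rewrite ler_wpM2l// ltW.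
pose U := fix U N : 'I_n -> {poly R} :=
  if N is N'.+1 then fun i => b i N' - mpz (Q i) (U N') else fun=> 0.
have UE N i : U N.+1 i = b i N - mpz (Q i) (U N) by [].
have nU N i : normp rho (U N i) <= d.
  elim: N i => [|N IH] i /=; first by rewrite normp0 ltW.
  apply: (le_trans (normpB _ _ (ltW rho_gt0))).
  have d01 : 0 <= d <= 1 by rewrite (ltW d0).
  have h1 := (hK i).2 rho d (U N) (ltW rho_gt0) d01 IH.
  have h2 : K i * d ^+ 2 <= d / 2.
    rewrite expr2 mulrA [d / 2]mulrC ler_pM2r//; apply: le_trans dK.
    by rewrite ler_pM2r//; exact: (KL0 i).1.
  by have := nb' i N; lra.
have Q0 i : peval (Q i) 0 = 0.
  by have := (hQ i).2 0; rewrite addr0 mxE addr0 => /eqP; rewrite addrC -subr_eq subrr => /eqP.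
have U0 N i : (U N i).[0] = 0.
  elim: N i => [|N IH] i /=; first by rewrite horner0.
  rewrite hornerD hornerN horner_coef0 b0 horner_mpz (_ : \row_j _ = 0) ?Q0 ?subrr//.
  by apply/rowP => j; rewrite !mxE IH.
have xU N i : dvdp 'X (U N i).
  by rewrite -['X]subr0 -polyC0 dvdp_XsubCl /root U0.
have dU N i : dvdp 'X^N (U N.+1 i - U N i).
  elim: N i => [|N IH] i; first by rewrite expr0 dvd1p.
  rewrite (UE N.+1) (UE N) (_ : _ - _ = (b i N.+1 - b i N) -
    (mpz (Q i) (U N.+1) - mpz (Q i) (U N))); last by ring.
  apply: dvdp_sub; last by apply: (order2_dvd (hQ i).1).
  rewrite (_ : b i N.+1 - b i N = truncp (c i) N.+2 - truncp (c i) N.+1); last by rewrite /b; ring.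
  by rewrite truncpS dvdp_mull.
move=> i.
apply: (@analytic_polys _ _ _ rho (`|x1 ord0 i| + d)
  (fun N => (x1 ord0 i)%:P + U N i)) => // [N|N|t tr].
- by rewrite opprD addrACA subrr add0r.
- by rewrite (le_trans (normpD _ _ (ltW rho_gt0)))// normpC lerD2l.
set s := t - t1; pose u := z t - x1; pose w N := \row_j (U N j).[s].
suff h : (fun N => `|w N - u|) @ \oo --> 0.
  apply/cvgrPdist_lt => e e0; move/cvgr0Pnorm_lt : h => /(_ e e0).
  apply: filterS => N; rewrite normr_id; apply: le_lt_trans.
  have := norm_coord (w N - u) i; rewrite !mxE => /(le_trans _); apply.
  by rewrite hornerD hornerC distrC opprB addrA [x1 ord0 i + _]addrC.
have ud : `|u| <= d by apply: hd'; apply: lt_le_trans tr ar.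
have wd N : `|w N| <= d.
  apply: norm_row_le => [|j]; first exact: ltW.
  rewrite mxE; apply: le_trans (nU N j); apply: horner_normp; exact: ltW.
(* The error of the truncated data at s; it tends to 0, and the distance to u at step N + 1 is at
   most this error plus half the distance at step N. *)
pose be N := \sum_j `|(b j N).[s] - (peval (P j) (z t) - c j 0%N)|.
apply: (@half_contraction _ be) => [//|N|].
- apply: norm_row_le => [|j].
    by rewrite addr_ge0 ?divr_ge0// sumr_ge0.
  have PE : peval (P j) (z t) - c j 0%N = u ord0 j + peval (Q j) u.
    have xu : x1 + u = z t by rewrite /u addrC subrK.
    have := (hQ j).2 u; rewrite xu => ->.
    by case: (hB j) => _ _ _ ->; ring.
  rewrite !mxE UE hornerD hornerN horner_mpz -/(w N).
  rewrite (_ : _ - _ = ((b j N).[s] - (peval (P j) (z t) - c j 0%N)) -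
    (peval (Q j) (w N) - peval (Q j) u)); last by rewrite PE !mxE; ring.
  rewrite (le_trans (ler_normB _ _))// lerD//.
    by rewrite /be (bigD1 j)//= lerDl sumr_ge0.
  apply: (le_trans ((hL j).2 d _ _ d1 (wd N) ud)); rewrite mulrC ler_wpM2l//.
  by apply: le_trans dK; rewrite ler_pM2r//; exact: (KL0 j).2.
have hb j : `|(b j N).[s] - (peval (P j) (z t) - c j 0%N)| @[N --> \oo] --> 0.
  suff h : (b j N).[s] - (peval (P j) (z t) - c j 0%N) @[N --> \oo] --> 0.
    by move/cvg_norm : h; rewrite normr0.
  rewrite -(subrr (peval (P j) (z t) - c j 0%N)); apply: cvgB; last exact: cvg_cst.
  rewrite (_ : (fun N => _) = (fun N => (truncp (c j) N.+1).[s] - c j 0%N)); last first.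
    by apply/funext => N; rewrite /b hornerD hornerN hornerC.
  apply: cvgB; last exact: cvg_cst.
  have [_ _ cv _] := hB j.
  have /cv : `|t - t1| < rho0 j by rewrite (lt_le_trans tr)// (le_trans rho_r).
  by rewrite -(cvg_shiftS (fun N => (truncp (c j) N).[s])).
rewrite /be; elim: (index_enum _) => [|j js IH].
  by rewrite (_ : (fun N => _) = fun=> 0); [exact: cvg_cst|
    apply/funext => N; rewrite big_nil].
have := cvgD (hb j) IH; rewrite addr0 => h.
rewrite (_ : (fun N => _) = (fun N => `|(b j N).[s] - (peval (P j) (z t) - c j 0%N)|) \+
  (fun N => \sum_(k <- js) `|(b k N).[s] - (peval (P k) (z t) - c k 0%N)|)); last first.
  by apply/funext => N; rewrite big_cons.
exact: h.
Qed.

Lemma analytic_inverse n (P : 'I_n -> mpoly n R) (z : R -> 'rV[R]_n) t1 :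
  (forall i, analytic_at (fun t => peval (P i) (z t)) t1) ->
  z t @[t --> t1] --> z t1 ->
  (\matrix_(i, j) peval (mderiv j (P i)) (z t1)) \in unitmx ->
  forall i, analytic_at (fun t => z t ord0 i) t1.
Proof.
set J := \matrix_(i, j) _ => aP cz uJ.
pose P' i := \sum_k mpolyC n (invmx J i k) * P k.
have P'E i x : peval (P' i) x = \sum_k invmx J i k * peval (P k) x.
  by rewrite peval_sum; apply: eq_bigr => k _; rewrite pevalM pevalC.
apply: (@analytic_inverse_id _ P') => // [i|i u].
  pose L := \sum_k mpolyC n (invmx J i k) * mpolyX R (mnm1 k).
  rewrite (_ : (fun t => _) = fun t => peval L (\row_k peval (P k) (z t))).
    apply: analytic_peval => k; rewrite (_ : (fun t => _) = fun t => peval (P k) (z t))//.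
    by apply/funext => t; rewrite mxE.
  apply/funext => t; rewrite P'E peval_sum; apply: eq_bigr => k _.
  by rewrite pevalM pevalC pevalX mxE.
rewrite dpeval_sum (eq_bigr (fun k => \sum_j u ord0 j * (invmx J i k * J k j))).
  rewrite exchange_big /= (bigD1 i)//= [X in _ + X]big1 ?addr0 => [|j ji].
    rewrite -mulr_sumr (_ : \sum_k _ = (invmx J *m J) i i); last by rewrite mxE.
    by rewrite mulVmx// mxE eqxx mulr1.
  rewrite -mulr_sumr (_ : \sum_k _ = (invmx J *m J) i j); last by rewrite mxE.
  by rewrite mulVmx// mxE eq_sym (negbTE ji) mulr0.
move=> k _; rewrite dpevalM dpevalC pevalC mul0r add0r mulr_sumr.
by apply: eq_bigr => j _; rewrite mxE mulrCA.
Qed.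

End AnalyticInverse.

(** * Local lifts of analytic arcs *)

Section LocalLift.
Variables (R : realType) (m : nat) (G : realAlgGroup R m).
Hypothesis Gcompact : compact (G : set 'rV[R]_m).
Variables (n : nat) (X : polyGset G n) (r : nat) (F : polymap R n r).
Hypothesis quotF : geometric_quotient X F.
Variable x0 : 'rV[R]_n.
Hypothesis Xx0 : pg_set X x0.
Hypothesis x0free : forall g, rag_set G g -> pg_act X g x0 = x0 -> g = rag_e G.

Local Notation inG x := (rag_set G x).
Local Notation act := (pg_act X).
Local Notation slice_fun := (slice_fun X x0 F).

Definition grad (q : mpoly n R) : 'rV[R]_n := \row_j peval (mderiv j q) x0.

Lemma dpeval_grad q v : dpeval q x0 v = (v *m (grad q)^T) ord0 ord0.
Proof. by rewrite mxE; apply: eq_bigr => j _; rewrite !mxE. Qed.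

Lemma slice_funD p q : slice_fun p -> slice_fun q -> slice_fun (p + q).
Proof.
move=> [p' hp] [q' hq]; exists (p' + q') => z Sz.
by rewrite !pevalD hp// hq.
Qed.

Lemma slice_funZ c q : slice_fun q -> slice_fun (mpolyC n c * q).
Proof.
move=> [q' hq]; exists (mpolyC r c * q') => z Sz.
by rewrite !pevalM !pevalC hq.
Qed.

(** As long as the span of the gradients is proper, some v <> 0 is orthogonal to it, and
    [slice_fun_separates] yields a gradient outside it. Only the row space of A matters, so it stays
    square. *)
Lemma slice_fun_grads k : (k <= n)%N -> exists A : 'M[R]_n,
  (forall u, exists2 q, slice_fun q & grad q = u *m A) /\ (k <= \rank A)%N.
Proof.
have W0 : slice_fun 0 by exists 0 => z _; rewrite -(mpolyC0 n) -(mpolyC0 r) !pevalC.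
elim: k => [|k IH] kn.
  exists 0; split=> // u; exists 0 => //; apply/rowP => j.
  by rewrite mulmx0 !mxE -(mpolyC0 n) mderivC -(mpolyC0 n) pevalC.
have [A [WA rA]] := IH (ltnW kn).
have [kA|Ak] := ltnP k (\rank A); first by exists A.
have /rowV0Pn[v vker v0] : kermx A^T != 0.
  by rewrite kermx_eq0 /row_free mxrank_tr neq_ltn (leq_ltn_trans Ak).
have vA : v *m A^T = 0 by apply/sub_kermxP.
have [q Wq dq] := slice_fun_separates Gcompact Xx0 x0free quotF v0.
exists (A + grad q)%MS; split=> [u|].
  have /sub_addsmxP[[a b] /= ->] : (u *m (A + grad q)%MS <= A + grad q)%MS by exact: submxMl.
  have [p Wp pE] := WA a; exists (p + mpolyC n (b ord0 ord0) * q).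
    by apply: slice_funD => //; exact: slice_funZ.
  apply/rowP => j; rewrite -pE !mxE big_ord1 !mxE.
  by rewrite mderivD mderiv_mulC pevalD pevalM pevalC [b]mx11_scalar !mxE.
apply: (leq_ltn_trans rA); apply: rank_ltmx; rewrite ltmxE addsmxSl /=.
apply: contra dq => /(submx_trans (addsmxSr _ _)) /submxP[D DE].
by rewrite dpeval_grad DE trmx_mul mulmxA vA mul0mx mxE.
Qed.

Lemma slice_chart : exists P : 'I_n -> mpoly n R,
  (forall i, slice_fun (P i)) /\ forall i u, dpeval (P i) x0 u = u ord0 i.
Proof.
have [A [WA rA]] := slice_fun_grads (leqnn n).
have uA : A \in unitmx by rewrite -row_full_unit /row_full eqn_leq rA rank_leq_row.
have /choice[P hP] : forall i : 'I_n, exists p, slice_fun p /\ grad p = delta_mx ord0 i.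
  move=> i; have [p Wp pE] := WA (delta_mx ord0 i *m invmx A); exists p.
  by split=> //; rewrite pE mulmxKV.
exists P; split=> [i|i u]; first exact: (hP i).1.
by rewrite dpeval_grad (hP i).2 trmx_delta -colE mxE.
Qed.

(** Near x0 the map P is the identity, up to a constant, plus a remainder with Lipschitz constant
    1/2, whence the factor 2. The Jacobian determinant is 1 at x0 and K-Lipschitz, so it cannot
    vanish within 1/K. *)
Lemma slice_chart_local (P : 'I_n -> mpoly n R) :
  (forall i u, dpeval (P i) x0 u = u ord0 i) -> exists2 d : R, 0 < d &
  (forall x y, `|x - x0| < d -> `|y - x0| < d ->
     `|x - y| <= 2 * \sum_i `|peval (P i) x - peval (P i) y|) /\
  (forall x, `|x - x0| < d ->
     (\matrix_(i, j) peval (mderiv j (P i)) x) \in unitmx).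
Proof.
move=> dP.
have /choice[Q hQ] : forall i, exists Q, order2 Q /\
    forall u, peval (P i) (x0 + u) = peval (P i) x0 + u ord0 i + peval Q u.
  by move=> i; have [Q oQ QE] := taylor_order2 (P i) x0; exists Q; split=> // u; rewrite QE dP.
have /choice[L hL] : forall i, exists K : R, 0 <= K /\
    forall (d : R) (u v : 'rV[R]_n), d <= 1 ->
    `|u| <= d -> `|v| <= d -> `|peval (Q i) u - peval (Q i) v| <= K * d * `|u - v|.
  by move=> i; have [K' K'0 h] := order2_lip (hQ i).1; exists K'.
pose M := \sum_i L i; have M0 : 0 <= M by apply: sumr_ge0 => i _; exact: (hL i).1.
have LM i : L i <= M by rewrite /M (bigD1 i)//= lerDl sumr_ge0// => j _; exact: (hL j).1.
pose d1 : R := (2 * (M + 1))^-1.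
have M1 : 0 < 2 * (M + 1) by lra.
have d10 : 0 < d1 by rewrite invr_gt0.
have dM : M * d1 <= 2^-1.
  by rewrite /d1 invfM mulrCA ler_piMr ?invr_ge0// ler_pdivrMr ?mul1r; lra.
have d11 : d1 <= 1 by rewrite /d1 invf_le1//; lra.
pose J := \matrix_(i, j) mderiv j (P i).
have JE x : (\matrix_(i, j) peval (mderiv j (P i)) x) = map_mx (meval (x ord0)) J.
  by apply/matrixP => i j; rewrite !mxE.
have detE x : \det (\matrix_(i, j) peval (mderiv j (P i)) x) = peval (\det J) x.
  by rewrite JE det_map_mx.
have J0 : peval (\det J) x0 = 1.
  rewrite -detE (_ : \matrix_(i, j) _ = 1%:M) ?det1//; apply/matrixP => i j.
  rewrite !mxE; have := dP i (delta_mx ord0 j); rewrite /dpeval (bigD1 j)//= big1.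
    by rewrite !mxE !eqxx mul1r addr0 => ->.
  by move=> k kj; rewrite mxE (negbTE kj) andbF mul0r.
have [K K0 hK] := polyfun_lipschitz (`|x0| + 1) (polyfun_peval (\det J)).
exists (Num.min d1 K^-1) => [|]; first by rewrite lt_min d10 invr_gt0.
split=> [x y|x]; rewrite !lt_min.
- move=> /andP[/ltW xd _] /andP[/ltW yd _].
  have xE : x0 + (x - x0) = x by rewrite addrC subrK.
  have yE : x0 + (y - x0) = y by rewrite addrC subrK.
  set s := \sum_i _; have s0 : 0 <= s by apply: sumr_ge0.
  suff : `|x - y| <= s + `|x - y| / 2 by lra.
  apply: norm_row_le => [|i]; first by rewrite addr_ge0// divr_ge0.
  rewrite (_ : (x - y) ord0 i = (peval (P i) x - peval (P i) y) -
      (peval (Q i) (x - x0) - peval (Q i) (y - x0))); last first.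
    have := (hQ i).2 (x - x0); have := (hQ i).2 (y - x0).
    by rewrite xE yE !mxE => -> ->; ring.
  rewrite (le_trans (ler_normB _ _))// lerD//.
    by rewrite /s (bigD1 i)//= lerDl sumr_ge0.
  apply: (le_trans ((hL i).2 d1 _ _ d11 xd yd)).
  rewrite opprB addrA subrK mulrC ler_wpM2l//.
  by apply: le_trans dM; rewrite ler_pM2r.
- move=> /andP[xd xK]; rewrite unitmxE unitfE detE; apply/negP => /eqP D0.
  have xn : `|x| <= `|x0| + 1.
    rewrite -(subrK x0 x) (le_trans (ler_normD _ _))// addrC lerD2l.
    by rewrite (le_trans (ltW xd)).
  have := hK x x0 xn (_ : `|x0| <= _); rewrite lerDl ler01 => /(_ isT).
  rewrite D0 J0 sub0r normrN normr1; apply/negP; rewrite -ltNge.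
  by rewrite mulrC -ltr_pdivlMr// mul1r.
Qed.

Variable Y : set 'rV[R]_n.
Hypothesis YX : Y `<=` pg_set X.
Hypothesis Y_act : forall g y, inG g -> Y y -> Y (act g y).

(** Invariants live on the Zariski closure X, but the arc has to be lifted to a G-stable subset Y,
    namely S. The lift must be analytic at every nearby t and not at t0 alone, because f is tested
    on whole arcs; so the chart is used at points other than x0 as well. *)
Lemma local_lift (D : R -> 'rV[R]_r) t0 (e : R) : 0 < e -> D t0 = pmeval F x0 ->
  (forall t, `|t - t0| < e -> (pmeval F @` Y) (D t)) ->
  (forall t, `|t - t0| < e -> forall i, analytic_at (fun s => D s ord0 i) t) ->
  exists2 d : R, 0 < d <= e & exists z : R -> 'rV[R]_n, forall t, `|t - t0| < d ->
    [/\ Y (z t), pmeval F (z t) = D t & forall i, analytic_at (fun s => z s ord0 i) t].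
Proof.
move=> e0 D0 DY aD.
have /choice[z hz] : forall t, exists z, `|t - t0| < e ->
    [/\ Y z, pmeval F z = D t & slice X x0 z].
  move=> t; have [te|] := boolP (`|t - t0| < e); last by exists 0.
  have [y Yy yE] := DY t te; have [g Gg gmin] := compact_idist_min Gcompact X y x0.
  have Xy := YX Yy.
  exists (act g y) => _; split; first exact: Y_act.
    by rewrite -yE; apply/rowP => i; rewrite !mxE; apply: quotF.1.
  split; first exact: pg_act_in.
  by move=> h Gh; rewrite -pg_actM//; apply/gmin/rag_mul_in.
have [P [SP dP]] := slice_chart.
have [eta eta0 [Plip Pdet]] := slice_chart_local dP.
have /choice[p hp] := SP.
have [c c0 hc] := idist_small Gcompact Xx0 eta0.
(* When D t is within c' of D t0, some point of the fibre, and therefore the nearest one z t, is at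
   distance below c from x0, which puts it in the domain of the chart. *)
have [c' c'0 hc'] := idist_proper Gcompact quotF Xx0 c0.
have [d d0 hd] : exists2 d : R, 0 < d <= e &
    forall t, `|t - t0| < d -> `|D t - D t0| < c'.
  have /choice[f hf] : forall i, exists d : R, 0 < d /\
      forall t, `|t - t0| < d -> `|D t ord0 i - D t0 ord0 i| < c'.
    move=> i; have t0e : `|t0 - t0| < e by rewrite subrr normr0.
    have /cvgrPdist_lt/(_ c' c'0)/nbhs_ballP[d /= d0 h] := analytic_continuous (aD t0 t0e i).
    by exists d; split=> // t td; rewrite distrC; apply: h; rewrite /ball /= distrC.
  have [d d0 hd] := common_radius (fun i => (hf i).1).
  exists (Num.min d e); first by rewrite lt_min d0 e0 ge_min lexx orbT.
  move=> t; rewrite lt_min => /andP[td _]; apply: norm_row_lt => // i; rewrite !mxE.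
  exact: (hf i).2 (lt_le_trans td (hd i)).
have /andP[d_gt0 de] := d0.
have ze t : `|t - t0| < d -> `|t - t0| < e by move=> /lt_le_trans; apply.
have zx0 t : `|t - t0| < d -> `|z t - x0| < eta.
  move=> td; have [Yz Fz [Xz zmin]] := hz t (ze t td); apply: (hc _ Xz).
  have [|g Gg] := hc' _ Xz; first by rewrite Fz -D0 hd.
  exact/le_lt_trans/zmin.
exists d => //; exists z => t1 t1d; have [Yz Fz _] := hz t1 (ze _ t1d); split=> //.
have PE t : `|t - t0| < d -> forall i, peval (P i) (z t) = peval (p i) (D t).
  by move=> td i; have [_ <- Sz] := hz t (ze t td); exact: hp.
have aP i : analytic_at (fun t => peval (P i) (z t)) t1.
  apply: eq_near_analytic (analytic_peval (p i) (aD t1 (ze _ t1d))).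
  by apply: filterS (near_abs_sub t1d) => t td; rewrite PE.
apply: (analytic_inverse aP _ (Pdet _ (zx0 _ t1d))).
apply/cvgrPdist_le => s s0.
(* The n terms of the chart inequality share s / 2; n + 1 keeps the denominator nonzero when n =
   0. *)
have n0 : 0 < s / (2 * n.+1%:R) by rewrite divr_gt0// mulr_gt0.
have /choice[f hf] : forall i, exists d : R, 0 < d /\ forall t, `|t - t1| < d ->
    `|peval (P i) (z t1) - peval (P i) (z t)| <= s / (2 * n.+1%:R).
  move=> i; have /cvgrPdist_le/(_ _ n0)/nbhs_ballP[d' /= d'0 h] := analytic_continuous (aP i).
  by exists d'; split=> // t td; apply: h; rewrite /ball /= distrC.
have [d' d'0 hd'] := common_radius (fun i => (hf i).1).
near=> t.
have td : `|t - t0| < d by near: t; exact: near_abs_sub.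
have td' : `|t - t1| < d' by near: t; exact: near_dist.
apply: (le_trans (Plip _ _ (zx0 _ t1d) (zx0 _ td))).
have h : \sum_i `|peval (P i) (z t1) - peval (P i) (z t)| <= \sum_(i < n) s / (2 * n.+1%:R).
  by apply: ler_sum => i _; exact: (hf i).2 (lt_le_trans td' (hd' i)).
apply: (le_trans (ler_wpM2l (ler0n _ 2) h)).
rewrite sumr_const card_ord -[_ *+ n]mulr_natr.
have n1 : n.+1%:R != 0 :> R by rewrite pnatr_eq0.
rewrite (_ : 2 * _ = s * (n%:R / n.+1%:R)); last by move: n.+1%:R n1 => w w0; field.
rewrite ler_piMr ?(ltW s0)// ler_pdivrMr// mul1r ler_nat.
exact: leqnSn.
Unshelve. all: by end_near. Qed.

End LocalLift.

(** * The induced map between the quotients *)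

Section QuotientMap.
Variables (R : realType) (m : nat) (G : realAlgGroup R m).
Hypothesis Gcompact : compact (G : set 'rV[R]_m).
Variables (n N : nat) (S : polyGset G n) (T : polyGset G N) (f : 'rV[R]_n -> 'rV[R]_N).
Hypothesis fST : set_fun S T f.
Hypothesis f_equivariant : equivariant S T f.
Variables (r s : nat) (F : polymap R n r) (E : polymap R N s).
Hypothesis quotF : semialgebraic_quotient S F.
Hypothesis quotE : semialgebraic_quotient T E.

(** The preimage selected by [xget] may be another point z, but it lies on the orbit of x, and the
    invariants of T take the same value at f z and at its translate f x. *)
Lemma quotient_mapE x : pg_set S x ->
  quotient_map S F E f (pmeval F x) = pmeval E (f x).
Proof.
move=> Sx; rewrite /quotient_map.
case: xgetP => [y _ [z [Sz Fz] <-]|/(_ (pmeval E (f x)))]; last first.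
  by case; exists x.
have [g Gg gz] := quotient_fibre Gcompact quotF
  (@sub_zariski_closure _ _ _ _ Sz) (@sub_zariski_closure _ _ _ _ Sx) Fz.
rewrite -gz [pg_act _ _ _]/(pg_act S g z) f_equivariant//.
apply/rowP => i; rewrite !mxE; apply/esym.
by apply: (quotE.1 i) => //; apply: sub_zariski_closure; exact: fST.
Qed.

End QuotientMap.

Theorem proposition7p2p8 (R : realType) (m : nat) (G : realAlgGroup R m)
  (Gcompact : compact (G : set 'rV[R]_m))
  (n N : nat) (S : polyGset G n) (T : polyGset G N)
  (Ssemialg : G_semialgebraic S) (Tsemialg : G_semialgebraic T)
  (f : 'rV[R]_n -> 'rV[R]_N)
  (f_arc_analytic : arc_analytic S T f)
  (f_equivariant : equivariant S T f)
  (Sfree : forall x, pg_set S x -> stabilizer S x = [set rag_e G])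
  (r s : nat) (piS : polymap R n r) (piT : polymap R N s)
  (piS_quotient : semialgebraic_quotient S piS)
  (piT_quotient : semialgebraic_quotient T piT) :
  arc_analytic (quotient_set S piS) (quotient_set T piT)
    (quotient_map S piS piT f).
Proof.
have [fST f_arc] := f_arc_analytic.
have qE := quotient_mapE Gcompact fST f_equivariant piS_quotient piT_quotient.
split=> [_ [x Sx <-]|D aD SD t0 t0I i].
  by rewrite /= qE//; exists (f x) => //; exact: fST.
have [x0 Sx0 Dx0] := SD t0 t0I; have /andP[t0l t0r] := t0I.
have x0free g : rag_set G g -> pg_act (Gclosure S) g x0 = x0 -> g = rag_e G.
  move=> Gg gx0; suff : stabilizer S x0 g by rewrite Sfree.
  by split.
pose e := Num.min (1 - t0) (1 + t0).
have e0 : 0 < e by rewrite lt_min subr_gt0 t0r /= -ltrBlDl sub0r.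
have eI t : `|t - t0| < e -> -1 < t < 1.
  by rewrite lt_min !ltr_norml => /andP[/andP[_ h1] /andP[h2 _]]; lra.
have [d /andP[d0 de] [z hz]] := local_lift Gcompact piS_quotient
  (@sub_zariski_closure _ _ _ _ Sx0) x0free (@sub_zariski_closure _ _ _)
  (fun g y Gg Sy => pg_act_in Gg Sy) e0 (esym Dx0)
  (fun t te => SD t (eI t te)) (fun t te => aD t (eI t te)).
have tau_lt tau : -1 < tau < 1 -> `|t0 + d * tau - t0| < d.
  move=> h; rewrite addrC addKr normrM gtr0_norm// gtr_pMr// ltr_norml//.
(* Arcs are parametrized by ]-1, 1[, so the lift on ]t0 - d, t0 + d[ is rescaled before [f_arc] is
   applied; only the conclusion at tau = 0 is used. *)
have a_gamma : analytic_arc (fun tau => z (t0 + d * tau)).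
  move=> tau tauI j; have [_ _ az] := hz _ (tau_lt _ tauI).
  exact: analytic_affine (az j).
have S_gamma tau : -1 < tau < 1 -> pg_set S (z (t0 + d * tau)).
  by move=> tauI; have [] := hz _ (tau_lt _ tauI).
have zeroI : -1 < (0 : R) < 1 by rewrite oppr_lt0 ltr01.
have a_fz j : analytic_at (fun t => f (z t) ord0 j) t0.
  have := f_arc _ a_gamma S_gamma 0 zeroI j.
  (* 0 is written as the image of t0 under the inverse rescaling, so that [analytic_affine] undoes
     it. *)
  rewrite (_ : 0 = - t0 / d + d^-1 * t0); last by field; rewrite gt_eqF.
  move=> /analytic_affine; apply: eq_near_analytic; near=> t.
  by rewrite /= (_ : t0 + d * _ = t)//; field; rewrite gt_eqF.
apply: eq_near_analytic (analytic_peval (piT i) a_fz).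
apply: filterS (near_dist t0 d0) => t td; have [Sz Fz _] := hz t td.
by rewrite /= -Fz qE// mxE.
Unshelve. all: by end_near. Qed.
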